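(* Every $5$-oriented Spherical Diagram with alignment $(2,3,3,3,3)$ has at least five swirls. Moreover, there exist $5$-oriented SDs with alignment $(2,3,3,3,3)$ having exactly five swirls and eight arcs, and $5$-oriented Spherical Occlusion Diagrams with alignment $(2,3,3,3,3)$ having exactly five swirls and nine arcs.
   Context: A geodesic arc on the unit sphere in $\mathbb R^3$ is the unique shortest curve joining two non-antipodal points. An arc $a$ blocks an arc $b$ (equivalently, $b$ hits $a$) if an endpoint of $b$ lies in the relative interior of $a$. A Spherical Diagram (SD) is a finite non-empty collection $\mathcal D$ of pairwise interior-disjoint geodesic arcs on the unit sphere such that each arc of $\mathcal D$ is blocked by arcs of $\mathcal D$ at each of its endpoints. A Spherical Occlusion Diagram (SOD) is an SD such that all arcs of $\mathcal D$ that hit the same arc of $\mathcal D$ reach it from the same side. A swirl of an SD is a cycle of arcs, each of which hits the next (and the last hits the first), going either all clockwise or all counterclockwise. An SD $\mathcal D$ is $k$-oriented if there exist a set $P$ of $k$ points on the unit sphere (poles), no two antipodal, and a function $f\colon\mathcal D\to P$ such that each arc $a\in\mathcal D$ lies on a great circle through $f(a)$ but contains neither $f(a)$ nor its antipode $-f(a)$. A $k$-oriented SD with poles $p_1,\dots,p_k$ has alignment $(d_1,\dots,d_k)$ (listed in nondecreasing order) if, for each $i$, there are exactly $d_i$ distinct great circles containing $p_i$ and at least one other pole. *)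

(* Defs.v *)
From HB Require Import structures.
From mathcomp Require Import all_boot all_order all_algebra.
From mathcomp Require Import Rstruct.

Set Implicit Arguments.
Unset Strict Implicit.
Unset Printing Implicit Defensive.
Import Order.TTheory GRing.Theory Num.Theory.
Local Open Scope ring_scope.

Notation R := Rdefinitions.R.

Definition pt := (R * R * R)%type.
Definition px (p : pt) : R := p.1.1.
Definition py (p : pt) : R := p.1.2.
Definition pz (p : pt) : R := p.2.
Definition dot (p q : pt) : R := px p * px q + py p * py q + pz p * pz q.
Definition det3 (p q r : pt) : R :=
  px p * (py q * pz r - pz q * py r) - py p * (px q * pz r - pz q * px r)
  + pz p * (px q * py r - py q * px r).
Definition padd (p q : pt) : pt := (px p + px q, py p + py q, pz p + pz q).
Definition pscale (s : R) (p : pt) : pt := (s * px p, s * py p, s * pz p).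
Definition popp (p : pt) : pt := pscale (-1) p.
Definition on_sphere (p : pt) : Prop := dot p p = 1.

Record sarc := SArc { src : pt; tgt : pt }.

(** A geodesic arc: the minor great-circle arc between two distinct,
    non-antipodal points of the unit sphere. *)
Definition geodesic_arc (a : sarc) : Prop :=
  on_sphere (src a) /\ on_sphere (tgt a) /\ src a <> tgt a /\ src a <> popp (tgt a).

Definition arc_interior (a : sarc) (w : pt) : Prop :=
  on_sphere w /\ exists s t : R, 0 < s /\ 0 < t /\
    w = padd (pscale s (src a)) (pscale t (tgt a)).

Definition arc_closed (a : sarc) (w : pt) : Prop :=
  on_sphere w /\ exists s t : R, 0 <= s /\ 0 <= t /\
    w = padd (pscale s (src a)) (pscale t (tgt a)).

Definition endpoint (a : sarc) (e : bool) : pt := if e then tgt a else src a.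
Definition other_endpoint (a : sarc) (e : bool) : pt := endpoint a (~~ e).

Definition spherical_diagram (n : nat) (D : 'I_n -> sarc) : Prop :=
  (0 < n)%N /\
  (forall i, geodesic_arc (D i)) /\
  (forall i j, i <> j -> forall w, arc_interior (D i) w -> ~ arc_interior (D j) w) /\
  (forall i (e : bool), exists j, arc_interior (D j) (endpoint (D i) e)).

(** Spherical Occlusion Diagram: all arcs hitting a given sarc [D a] reach it
    from the same side of its great circle (side measured by the other
    endpoint of the hitting sarc). *)
Definition spherical_occlusion_diagram (n : nat) (D : 'I_n -> sarc) : Prop :=
  spherical_diagram D /\
  forall (a b c : 'I_n) (eb ec : bool),
    arc_interior (D a) (endpoint (D b) eb) ->
    arc_interior (D a) (endpoint (D c) ec) ->
    0 < det3 (src (D a)) (tgt (D a)) (other_endpoint (D b) eb)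
        * det3 (src (D a)) (tgt (D a)) (other_endpoint (D c) ec).

Definition oriented (n k : nat) (D : 'I_n -> sarc) (P : 'I_k -> pt)
    (f : 'I_n -> 'I_k) : Prop :=
  (forall i, on_sphere (P i)) /\
  injective P /\
  (forall i j, P i <> popp (P j)) /\
  (forall a, det3 (src (D a)) (tgt (D a)) (P (f a)) = 0 /\
             ~ arc_closed (D a) (P (f a)) /\
             ~ arc_closed (D a) (popp (P (f a)))).

(** Number of distinct great circles containing pole i and at least one
    other pole: each such great circle is represented by the set of other
    poles lying on it. *)
Definition alignment_deg (k : nat) (P : 'I_k -> pt) (i : 'I_k) : nat :=
  #|[set [set l | (l != i) && (det3 (P i) (P j) (P l) == 0)] | j in [set j | j != i]]|.

Definition has_alignment (k : nat) (P : 'I_k -> pt) (ds : seq nat) : Prop :=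
  perm_eq [seq alignment_deg P i | i <- enum 'I_k] ds.

(** A swirl: a cycle [s] of distinct arcs, each hitting the next (cyclically),
    all turns in the same direction.  [e a] is the endpoint of sarc [a] that
    hits the next sarc; the turn at the hit point is the side of the great
    circle of [a] (oriented towards the hit) on which the forward endpoint
    of the next sarc lies. *)
Definition swirl (n : nat) (D : 'I_n -> sarc) (s : seq 'I_n) : Prop :=
  uniq s /\ (0 < size s)%N /\
  exists (e : 'I_n -> bool) (cw : bool),
    forall a, a \in s ->
      arc_interior (D (next s a)) (endpoint (D a) (e a)) /\
      (let t := det3 (other_endpoint (D a) (e a)) (endpoint (D a) (e a))
                     (endpoint (D (next s a)) (e (next s a))) in
       if cw then t < 0 else 0 < t).

Definition swirl_equiv (n : nat) (s t : seq 'I_n) : Prop := exists k, t = rot k s.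

Definition at_least_swirls (n : nat) (D : 'I_n -> sarc) (m : nat) : Prop :=
  exists S : 'I_m -> seq 'I_n,
    (forall i, swirl D (S i)) /\
    (forall i j, i <> j -> ~ swirl_equiv (S i) (S j)).

Definition exactly_swirls (n : nat) (D : 'I_n -> sarc) (m : nat) : Prop :=
  exists S : 'I_m -> seq 'I_n,
    (forall i, swirl D (S i)) /\
    (forall i j, i <> j -> ~ swirl_equiv (S i) (S j)) /\
    (forall s, swirl D s -> exists i, swirl_equiv (S i) s).

(* Main.v *)
(** Each arc lies on an open half great circle from [-p] to [p] for its pole [p], so it can be
    directed towards [p] or towards [-p].  Choosing a sign for every pole so that the signed
    poles lie in an open hemisphere, every arc that meets their convex cone [K] has an end in
    [K].  Such a cone contains a swirl: from an arc entering [K], keep turning left.  If the walk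
    never leaves [K] it ends in a swirl; otherwise it cuts off a convex pocket of [K] and leaves
    through an arc that, traversed backwards, enters [K].  From there keep turning right, and so
    on.  Walls of a pocket are arcs, which other arcs cannot cross, so each pocket strictly
    contains the previous one, and the alternation must stop.

    With alignment (2,3,3,3,3) the poles can be rescaled to [o, a, b, c, d] with
    [a + b + c + d = 0] and [o = a + b].  The sign vectors +-+-+, +--++, -++-+, -+-++ and --++-
    (in the order [a, b, c, d, o]) give five cones that are pairwise separated by planes.  Three
    consecutive hit points of a swirl are not coplanar with the origin, hence the five swirls
    are distinct.

    The two extremal diagrams are given by integer vectors and checked by computation. *)
From Stdlib Require Import ZArith.
From Stdlib Require RIneq.
Require Import Defs.
From mathcomp Require Import all_boot all_order all_algebra.
From mathcomp Require Import Rstruct.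
From mathcomp Require Import boolp ring lra zify.

Set Implicit Arguments.
Unset Strict Implicit.
Unset Printing Implicit Defensive.
Import Order.TTheory GRing.Theory Num.Theory.
Local Open Scope ring_scope.

Local Notation "u +v v" := (padd u v) (at level 50, left associativity).
Local Notation "s *v u" := (pscale s u) (at level 40, left associativity).

(** * Vectors and arcs *)

(** Points matter only up to a positive factor: arcs become open planar cones, and incidences, sides
    and turns become signs of dot products and determinants. No topology is used: the point where a
    segment leaves a region bounded by finitely many planes is the minimum of finitely many
    quotients. The obstacle is that a chain turning to one side inside [K] need not close up at its
    starting arc; it may spiral inwards and close on a later one. Hence two invariants: either the
    polygon traced so far is convex ([invA]), or the line of the last arc meets an earlier side
    ([invB]), and then the chain stays shut in until it repeats an arc. So only a convex chain can
    leave [K]. Growth of pockets is measured by the number of arcs that meet their interior. The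
    sign vectors are regions of the arrangement of the five planes orthogonal to the poles. A plane
    separating two cones is given by a nonzero [h] in the closed region of one sign vector and in
    the closed region opposite to the other, so the five vectors were to be chosen such that these
    regions touch for every pair. *)

Definition cross (a b : pt) : pt :=
  (py a * pz b - pz a * py b, pz a * px b - px a * pz b, px a * py b - py a * px b).

Lemma dotD n u v : dot n (u +v v) = dot n u + dot n v.
Proof. by rewrite /dot /padd /px /py /pz /=; ring. Qed.

Lemma dotZ n s u : dot n (s *v u) = s * dot n u.
Proof. by rewrite /dot /pscale /px /py /pz /=; ring. Qed.

Lemma dotZl n s u : dot (s *v n) u = s * dot n u.
Proof. by rewrite /dot /pscale /px /py /pz /=; ring. Qed.

Lemma dotDl n m u : dot (n +v m) u = dot n u + dot m u.
Proof. by rewrite /dot /padd /px /py /pz /=; ring. Qed.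

Lemma dotN n u : dot n (popp u) = - dot n u.
Proof. by rewrite dotZ mulN1r. Qed.

Lemma dotC u v : dot u v = dot v u.
Proof. by rewrite /dot; ring. Qed.

Lemma dot_cross a b u : dot (cross a b) u = det3 a b u.
Proof. by rewrite /dot /cross /det3 /px /py /pz /=; ring. Qed.

Lemma pt_ext u v : (forall n, dot n u = dot n v) -> u = v.
Proof.
case: u v => [[u1 u2] u3] [[v1 v2] v3] h.
have := h (1, 0, 0); have := h (0, 1, 0); have := h (0, 0, 1).
by rewrite /dot /px /py /pz /= !mul0r !mul1r !addr0 !add0r => -> -> ->.
Qed.

Definition dotE := (dotD, dotZ).

Lemma det3_cyc a b c : det3 a b c = det3 b c a.
Proof. by rewrite /det3; ring. Qed.

Lemma det3_swap a b c : det3 b a c = - det3 a b c.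
Proof. by rewrite /det3; ring. Qed.

Lemma det3_ll a c : det3 a a c = 0.
Proof. by rewrite /det3; ring. Qed.

Lemma det3_dup a b : (det3 a b a = 0) * (det3 a b b = 0).
Proof. by rewrite /det3; split; ring. Qed.

Lemma dot_sq_ge0 u : 0 <= dot u u.
Proof. by rewrite /dot; nra. Qed.

Lemma dot_sq_eq0 u : dot u u = 0 -> forall n, dot n u = 0.
Proof.
case: u => [[u1 u2] u3]; rewrite /dot /px /py /pz /= => h [[a b] c] /=.
have -> : u1 = 0 by nra.
have -> : u2 = 0 by nra.
have -> : u3 = 0 by nra.
ring.
Qed.

(** Cramer's rule in the basis [a], [b], [cross a b], cleared of its denominator. The vector
    identity is tested against an arbitrary [n], as everywhere with [pt_ext]. *)
Lemma cross_expand a b u n :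
  dot (cross a b) (cross a b) * dot n u =
  det3 u b (cross a b) * dot n a + det3 a u (cross a b) * dot n b
  + det3 a b u * dot n (cross a b).
Proof.
case: a b u n => [[a1 a2] a3] [[b1 b2] b3] [[u1 u2] u3] [[n1 n2] n3].
by rewrite /det3 /dot /cross /px /py /pz /=; ring.
Qed.

Lemma coplanar_span a b u : dot (cross a b) (cross a b) != 0 -> det3 a b u = 0 ->
  exists s t, u = s *v a +v t *v b.
Proof.
move=> h0 h1; pose k := dot (cross a b) (cross a b).
exists (k^-1 * det3 u b (cross a b)), (k^-1 * det3 a u (cross a b)).
apply: pt_ext => n; rewrite !dotE; apply: (mulfI h0).
by rewrite cross_expand h1 -/k; field.
Qed.

Lemma lagrange a b : dot (cross a b) (cross a b) = dot a a * dot b b - dot a b ^+ 2.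
Proof. by rewrite /dot /cross /px /py /pz /=; ring. Qed.

Lemma unit_dot_lt1 a b : on_sphere a -> on_sphere b -> a <> b -> dot a b < 1.
Proof.
rewrite /on_sphere => ha hb hab; rewrite ltNge; apply/negP => h; apply: hab.
apply: pt_ext => n.
have e : dot (a +v (-1) *v b) (a +v (-1) *v b) = 0.
  apply: le_anti; rewrite dot_sq_ge0 andbT.
  by rewrite !(dotE, dotZl, dotDl) ha hb (dotC b a); lra.
by have := dot_sq_eq0 e n; rewrite !dotE; lra.
Qed.

Lemma on_sphereN a : on_sphere a -> on_sphere (popp a).
Proof. by rewrite /on_sphere dotN dotC dotN => ->; lra. Qed.

Lemma unit_dot_gtN1 a b : on_sphere a -> on_sphere b -> a <> popp b -> -1 < dot a b.
Proof.
by move=> ha hb hab; have := unit_dot_lt1 ha (on_sphereN hb) hab; rewrite dotN; lra.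
Qed.

Lemma indep_cross a b : on_sphere a -> on_sphere b -> a <> b -> a <> popp b ->
  dot (cross a b) (cross a b) != 0.
Proof.
move=> ha hb h1 h2; rewrite lagrange ha hb.
have := unit_dot_lt1 ha hb h1; have := unit_dot_gtN1 ha hb h2.
by move=> ? ?; apply/eqP; nra.
Qed.

Lemma indep_eq0 a b s t : dot (cross a b) (cross a b) != 0 ->
  (forall n, s * dot n a + t * dot n b = 0) -> s = 0 /\ t = 0.
Proof.
move=> h0 h; split; apply/eqP; rewrite -(mulIr_eq0 _ (mulIf h0)); apply/eqP.
  have := h (cross b (cross a b)); rewrite !dot_cross.
  have -> : det3 b (cross a b) b = 0 by rewrite det3_cyc det3_cyc det3_ll.
  by rewrite mulr0 addr0 -det3_cyc -dot_cross.
have := h (cross (cross a b) a); rewrite !dot_cross.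
have -> : det3 (cross a b) a a = 0 by rewrite det3_cyc det3_ll.
by rewrite mulr0 add0r det3_cyc -dot_cross.
Qed.

Definition sg (cw : bool) : R := if cw then -1 else 1.

Lemma sgN cw : sg (~~ cw) = - sg cw.
Proof. by case: cw; rewrite /sg /=; lra. Qed.

(** * Directed arcs, their planes and their turns *)

Section Diagram.

Variables (n : nat) (D : 'I_n -> sarc).
Hypothesis SD : spherical_diagram D.

Notation state := ('I_n * bool)%type.
Implicit Types (q : state) (a : 'I_n) (u v : pt).

(** A state [(a, e)] is the arc [a] traversed towards its end [e]; [flip] reverses the traversal. *)
Definition tip q := endpoint (D q.1) q.2.
Definition tail q := other_endpoint (D q.1) q.2.
Definition flip q : state := (q.1, ~~ q.2).

Lemma tip_flip q : tip (flip q) = tail q.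
Proof. by []. Qed.

Lemma tail_flip q : tail (flip q) = tip q.
Proof. by case: q => a []. Qed.

(** The cone over the open arc: [arc_interior] without the unit norm, hence stable under positive
    scaling. *)
Definition inarc a u := exists s t : R, 0 < s /\ 0 < t /\ u = s *v src (D a) +v t *v tgt (D a).

Lemma inarcE q u : inarc q.1 u <-> exists s t : R, 0 < s /\ 0 < t /\ u = s *v tail q +v t *v tip q.
Proof.
case: q => a []; rewrite /tip /tail /=; first by split.
split => -[s [t [hs [ht ->]]]]; exists t, s; do 2!split=> //;
  by apply: pt_ext => m; rewrite !dotE addrC.
Qed.

Lemma tail_sphere q : on_sphere (tail q).
Proof. by case: SD => _ [h _]; case: q => a []; case: (h a) => ? []. Qed.

Lemma tip_sphere q : on_sphere (tip q).
Proof. by rewrite -tail_flip; apply: tail_sphere. Qed.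

Lemma state_indep q : dot (cross (tail q) (tip q)) (cross (tail q) (tip q)) != 0.
Proof.
case: SD => _ [/(_ q.1) [h1 [h2 [h3 h4]]] _].
case: q h1 h2 h3 h4 => a []; rewrite /tip /tail /other_endpoint /endpoint /= => h1 h2 h3 h4;
  apply: indep_cross => // h.
- by apply: h3.
by apply: h4; apply: pt_ext => m; have := congr1 (dot m) h; rewrite !dotN; lra.
Qed.

Lemma inarc_unit a u : inarc a u -> exists2 c : R, 0 < c & arc_interior (D a) (c *v u).
Proof.
move=> [s [t [hs [ht eu]]]].
have hu : 0 < dot u u.
  rewrite lt_neqAle dot_sq_ge0 andbT eq_sym; apply/eqP => /dot_sq_eq0 h.
  have [s0 _] : s = 0 /\ t = 0.
    apply: (@indep_eq0 (src (D a)) (tgt (D a))); first exact: (state_indep (a, true)).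
    by move=> m; rewrite -(h m) eu !dotE.
  by rewrite s0 ltxx in hs.
have hc : 0 < (Num.sqrt (dot u u))^-1 by rewrite invr_gt0 sqrtr_gt0.
exists (Num.sqrt (dot u u))^-1 => //; split.
  rewrite /on_sphere !(dotE, dotZl) mulrA -expr2 exprVn sqr_sqrtr ?ltW // mulVf //.
  by rewrite gt_eqF.
exists ((Num.sqrt (dot u u))^-1 * s), ((Num.sqrt (dot u u))^-1 * t).
split; first exact: mulr_gt0. split; first exact: mulr_gt0.
by apply: pt_ext => m; rewrite eu !dotE; ring.
Qed.

Lemma inarc_inj a b u : inarc a u -> inarc b u -> a = b.
Proof.
move=> ha hb; apply: contrapT => hab.
have [c hc h] := inarc_unit ha.
case: SD => _ [_ [/(_ a b hab _ h) hno _]]; apply: hno.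
split; first by case: h.
case: hb => [s [t [hs [ht ->]]]]; exists (c * s), (c * t).
split; first exact: mulr_gt0. split; first exact: mulr_gt0.
by apply: pt_ext => m; rewrite !dotE; ring.
Qed.

(** A normal of the plane of the arc; it points to the side towards which a chain of sense [cw]
    turns, so that one argument serves both senses. *)
Definition nrm cw q := sg cw *v cross (tail q) (tip q).

Lemma nrmE cw q u : dot (nrm cw q) u = sg cw * det3 (tail q) (tip q) u.
Proof. by rewrite dotZl dot_cross. Qed.

Lemma nrm_tip cw q : dot (nrm cw q) (tip q) = 0.
Proof. by rewrite nrmE det3_dup mulr0. Qed.

Lemma nrm_tail cw q : dot (nrm cw q) (tail q) = 0.
Proof. by rewrite nrmE det3_dup mulr0. Qed.

Lemma nrm_inarc cw q u : inarc q.1 u -> dot (nrm cw q) u = 0.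
Proof. by move=> /inarcE [s [t [_ [_ ->]]]]; rewrite !dotE nrm_tip nrm_tail; ring. Qed.

Lemma nrm_flip cw q u : dot (nrm cw (flip q)) u = - dot (nrm cw q) u.
Proof. by rewrite !nrmE tail_flip tip_flip det3_swap mulrN. Qed.

Lemma nrmN cw q u : dot (nrm (~~ cw) q) u = - dot (nrm cw q) u.
Proof. by rewrite !nrmE sgN mulNr. Qed.

Lemma nrm_eq0 cw q u : dot (nrm cw q) u = 0 -> exists s t, u = s *v tail q +v t *v tip q.
Proof.
rewrite nrmE => /eqP; rewrite mulf_eq0 => /orP [|/eqP h].
  by case: cw; rewrite /sg => /eqP; lra.
exact: coplanar_span (state_indep q) h.
Qed.

Lemma tip_notin q : ~ inarc q.1 (tip q).
Proof.
move=> /inarcE [s [t [hs [ht e]]]].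
have [s0 _] : s = 0 /\ t - 1 = 0.
  apply: (indep_eq0 (state_indep q)) => m; have := congr1 (dot m) e; rewrite !dotE; lra.
by rewrite s0 ltxx in hs.
Qed.

Definition follows cw q q' := [/\ arc_interior (D q'.1) (tip q), inarc q'.1 (tip q)
  & 0 < dot (nrm cw q) (tip q')].

(** The hit point is a positive combination of the ends of the blocking arc, so these lie on
    opposite sides of the plane of [q], and one of them is on the side of the turn. The exception
    would be a blocker in that plane, which would overlap [q] near its tip. *)
Lemma follows_exists cw q : exists q', follows cw q q'.
Proof.
case: SD => _ [_ [_ /(_ q.1 q.2) [j hj]]].
have hin : inarc j (tip q).
  by case: hj => _ [s [t [? [? e]]]]; exists s, t.
have [h|h|h0] := ltgtP 0 (dot (nrm cw q) (tgt (D j))).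
- by exists (j, true); split.
- exists (j, false); split => //.
  case: hin => s [t [hs [ht e]]]; have := congr1 (dot (nrm cw q)) e.
  by rewrite nrm_tip !dotE /tip /= => ?; nra.
have h1 : dot (nrm cw q) (src (D j)) = 0.
  case: hin => s [t [hs [ht e]]]; have := congr1 (dot (nrm cw q)) e.
  rewrite nrm_tip !dotE -h0 mulr0 addr0 => /esym /eqP.
  by rewrite mulf_eq0 gt_eqF //= => /eqP.
have htl : dot (nrm cw (j, true)) (tail q) = 0.
  have [s1 [t1 e1]] := nrm_eq0 h1.
  have [s2 [t2 e2]] := nrm_eq0 (esym h0).
  rewrite nrmE.
  have -> : tail (j, true) = src (D j) by [].
  have -> : tip (j, true) = tgt (D j) by [].
  rewrite e1 e2 /det3.
  by rewrite /padd /pscale /px /py /pz /=; ring.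
have [al [be et]] := nrm_eq0 htl.
case: (hin) => s [t [hs [ht e]]].
(* So small that moving from the tip by [d] times the tail keeps both coefficients over the ends of
   [j] positive. *)
pose d := Num.min (s / (2 * (1 + `|al|))) (t / (2 * (1 + `|be|))).
have hA : 0 < 2 * (1 + `|al|) by have := normr_ge0 al; lra.
have hB : 0 < 2 * (1 + `|be|) by have := normr_ge0 be; lra.
have hd : 0 < d by rewrite lt_min !divr_gt0.
have hd1 : d * `|al| < s.
  have : d <= s / (2 * (1 + `|al|)) by rewrite ge_min lexx.
  rewrite ler_pdivlMr // => h; have := normr_ge0 al; nra.
have hd2 : d * `|be| < t.
  have : d <= t / (2 * (1 + `|be|)) by rewrite ge_min lexx orbT.
  rewrite ler_pdivlMr // => h; have := normr_ge0 be; nra.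
exfalso; have ej : q.1 = j.
  apply: (@inarc_inj _ _ (d *v tail q +v 1 *v tip q)).
    by apply/inarcE; exists d, 1.
  exists (s + d * al), (t + d * be); split.
    by have := ler_norm (- al); rewrite normrN; nra.
  split; first by have := ler_norm (- be); rewrite normrN; nra.
  by apply: pt_ext => m; rewrite !dotE et e !dotE /tip /tail /=; ring.
by rewrite -ej in hin; apply: (tip_notin hin).
Qed.

(** Writing the hit point as [s *v tail q' +v t *v tip q'] shows that the two determinants differ by
    the factor [s]: a turn has the same sense seen from either arc. *)
Lemma follows_tail cw q q' : follows cw q q' -> 0 < dot (nrm cw q') (tail q).
Proof.
move=> [_ /inarcE [s [t [hs [ht e]]]]]; rewrite !nrmE e => h.
have : 0 < t * s * (sg cw * det3 (tail q) (s *v tail q' +v t *v tip q') (tip q')).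
  by rewrite pmulr_rgt0 // mulr_gt0.
have -> : det3 (tail q) (s *v tail q' +v t *v tip q') (tip q') = s * det3 (tail q') (tip q') (tail q).
  by rewrite /det3 /padd /pscale /px /py /pz /=; ring.
move=> h1; have h2 : 0 < t * s * s by rewrite !mulr_gt0.
rewrite -(pmulr_rgt0 _ h2).
by move: h1; congr (_ < _); ring.
Qed.

End Diagram.

(** * Chains of arcs turning to the same side *)

(** Each wall violated at [u'] is crossed at an explicit quotient; the exit time [t] is the least of
    them. *)
Lemma first_exit (N : nat -> pt) m u u' :
  (forall k, (k <= m)%N -> 0 <= dot (N k) u) ->
  (exists2 k, (k <= m)%N & dot (N k) u' < 0) ->
  exists t, [/\ 0 <= t, t < 1,
    forall k, (k <= m)%N -> 0 <= dot (N k) ((1 - t) *v u +v t *v u') &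
    exists k, [/\ (k <= m)%N, dot (N k) u' < 0 & dot (N k) ((1 - t) *v u +v t *v u') = 0]].
Proof.
move=> hu [k0 hk0 hn].
pose r (k : 'I_m.+1) := dot (N k) u / (dot (N k) u - dot (N k) u').
have P0 : dot (N (Ordinal (hk0 : (k0 < m.+1)%N))) u' < 0 by [].
case: (arg_minP r (P := fun k : 'I_m.+1 => dot (N k) u' < 0) P0) => k hk hmin.
have hD (l : 'I_m.+1) : dot (N l) u' < 0 -> 0 < dot (N l) u - dot (N l) u'.
  by have := hu l (ltn_ord l); lra.
have er : r k * (dot (N k) u - dot (N k) u') = dot (N k) u by rewrite divfK // gt_eqF // hD.
have h0 := hu k (ltn_ord k).
exists (r k); split.
- by rewrite divr_ge0 // ltW // hD.
- by rewrite ltr_pdivrMr ?hD //; lra.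
- move=> l hl; rewrite !dotE.
  have [hl'|hl'] := ltP (dot (N l) u') 0.
    have := hmin (Ordinal (hl : (l < m.+1)%N)) hl'; rewrite {2}/r /=.
    by rewrite ler_pdivlMr ?(hD (Ordinal (hl : (l < m.+1)%N))) //; lra.
  have r0 : 0 <= r k by rewrite divr_ge0 // ltW // hD.
  have r1 : r k < 1 by rewrite ltr_pdivrMr ?hD //; lra.
  by have := hu l hl; nra.
- exists k; split => //; first by rewrite -ltnS.
  by rewrite !dotE; lra.
Qed.

Lemma last_index (P : nat -> Prop) i j : (i <= j)%N -> P i ->
  exists k, [/\ (i <= k)%N, (k <= j)%N, P k & forall l, (k < l)%N -> (l <= j)%N -> ~ P l].
Proof.
move=> hij hi; elim: j hij => [|j IH] hij.
  by exists i; split=> //; move: hij; rewrite leqn0 => /eqP -> l; lia.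
have [hP|hP] := EM (P j.+1).
  by exists j.+1; split=> // l; lia.
have hij' : (i <= j)%N.
  by move: hij; rewrite leq_eqVlt => /orP [/eqP e|//]; case: hP; rewrite -e.
have [k [h1 h2 h3 h4]] := IH hij'; exists k; split=> //; first lia.
move=> l hl; rewrite leq_eqVlt => /orP [/eqP -> //|hl2]; exact: h4.
Qed.

Section Chain.

Variables (n : nat) (D : 'I_n -> sarc).
Hypothesis SD : spherical_diagram D.
Notation state := ('I_n * bool)%type.

Variables (cw : bool) (nx : state -> state).
Hypothesis nxP : forall q, follows D cw q (nx q).

Variables (K : pt -> Prop) (y : pt).
Hypothesis KD : forall u v, K u -> K v -> K (u +v v).
Hypothesis KZ : forall s u, 0 < s -> K u -> K (s *v u).
Hypothesis Ky : forall u, K u -> 0 < dot y u.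

Lemma K_comb s t u v : 0 <= s -> 0 <= t -> 0 < s + t -> K u -> K v -> K (s *v u +v t *v v).
Proof.
rewrite le_eqVlt => /orP [/eqP <-|hs].
  move=> _ ht _ Kv; have -> : 0 *v u +v t *v v = t *v v.
    by apply: pt_ext => m; rewrite !dotE; ring.
  by apply: KZ => //; lra.
rewrite le_eqVlt => /orP [/eqP <-|ht] _ Ku Kv.
  have -> : s *v u +v 0 *v v = s *v u by apply: pt_ext => m; rewrite !dotE; ring.
  exact: KZ.
by apply: KD; apply: KZ.
Qed.

Variables (q0 : state) (x0 : pt).
Hypothesis x0_in : inarc D q0.1 x0.
Hypothesis Kx0 : K x0.
Hypothesis tail_out : ~ K (tail D q0).
Hypothesis tip_K : K (tip D q0).

Definition st k := iter k nx q0.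
(** The polygon of the chain starts at the entry point [x0] in [K], since the tail of [q0] is
    outside; its side from [vtx k] to [vtx k.+1] lies on the arc of [st k]. *)
Definition vtx k := if k is k'.+1 then tip D (st k') else x0.
Definition nv k := nrm D cw (st k).

Lemma vtx_in k : inarc D (st k).1 (vtx k).
Proof. by case: k => [//|k] /=; case: (nxP (st k)). Qed.

Lemma nv_vtx k : dot (nv k) (vtx k) = 0.
Proof. exact: nrm_inarc (vtx_in k). Qed.

Lemma nv_vtxS k : dot (nv k) (vtx k.+1) = 0.
Proof. exact: nrm_tip. Qed.

Lemma nv_prev k : 0 < dot (nv k.+1) (vtx k).
Proof.
have /inarcE [s [t [hs [ht ->]]]] := vtx_in k.
rewrite !dotE.
have -> : dot (nv k.+1) (tip D (st k)) = 0 := nv_vtx k.+1.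
by rewrite mulr0 addr0 mulr_gt0 // (follows_tail (nxP (st k))).
Qed.

Lemma nv_next k : 0 < dot (nv k) (vtx k.+2).
Proof. by have [_ _] := nxP (st k). Qed.

Lemma comb_inarc k al be : 0 < al -> 0 <= be ->
  inarc D (st k).1 (al *v vtx k +v be *v vtx k.+1).
Proof.
move=> ha hb; have /inarcE [s [t [hs [ht ->]]]] := vtx_in k; apply/inarcE.
exists (al * s), (al * t + be); split; first exact: mulr_gt0.
split; first by have := mulr_gt0 ha ht; lra.
by apply: pt_ext => m; rewrite !dotE /=; ring.
Qed.

Lemma nv_span k u : dot (nv k) u = 0 -> exists al be, u = al *v vtx k +v be *v vtx k.+1.
Proof.
move=> h; have [s [t e]] := nrm_eq0 SD h.
have /inarcE [a [b [ha [hb ev]]]] := vtx_in k.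
exists (s / a), (t - s * b / a); rewrite e ev; apply: pt_ext => m; rewrite !dotE /=.
by field; rewrite gt_eqF.
Qed.

Lemma inarc_scale a s u : 0 < s -> inarc D a u -> inarc D a (s *v u).
Proof.
move=> hs [s1 [t1 [h1 [h2 ->]]]]; exists (s * s1), (s * t1).
by do 2!(split; first exact: mulr_gt0); apply: pt_ext => m; rewrite !dotE; ring.
Qed.

(** The far end of side [k] is not interior to its own arc, but it is interior to the arc it hits;
    this is the second alternative. *)
Lemma seg_inarc k al be u : 0 <= al -> 0 <= be -> u = al *v vtx k +v be *v vtx k.+1 -> K u ->
  inarc D (st k).1 u \/ inarc D (st k.+1).1 u.
Proof.
rewrite le_eqVlt => /orP [/eqP <-|ha] hb e Ku; last by left; rewrite e; apply: comb_inarc.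
right; have -> : u = be *v vtx k.+1 by apply: pt_ext => m; rewrite e !dotE; ring.
apply: inarc_scale; last exact: vtx_in.
by have := Ky Ku; rewrite e !dotE; move: hb; rewrite le_eqVlt => /orP [/eqP <-|//]; lra.
Qed.

(** In the plane of side [k.+1], the neighbouring planes cut out exactly that side: each of them
    contains one of its ends and has the other strictly on its positive side. *)
Lemma wall_mid k u : dot (nv k.+1) u = 0 -> 0 <= dot (nv k) u -> 0 <= dot (nv k.+2) u ->
  exists al be, [/\ 0 <= al, 0 <= be & u = al *v vtx k.+1 +v be *v vtx k.+2].
Proof.
move=> h0 h1 h2; have [al [be e]] := nv_span h0; exists al, be; split => //.
  by move: h2; rewrite e !dotE nv_vtx mulr0 addr0 pmulr_lge0 // nv_prev.
by move: h1; rewrite e !dotE nv_vtxS mulr0 add0r pmulr_lge0 // nv_next.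
Qed.

(** No earlier plane bounds side 0 from behind, but [K] does: were [u] at or beyond the tail, the
    tail would be a combination of [u] and the tip with nonnegative coefficients, hence in [K]. *)
Lemma wall0 u : K u -> dot (nv 0) u = 0 -> 0 <= dot (nv 1) u ->
  inarc D (st 0).1 u \/ inarc D (st 1).1 u.
Proof.
move=> Ku h0 h1; have [al [be e]] := nv_span h0.
have ha : 0 <= al by move: h1; rewrite e !dotE nv_vtx mulr0 addr0 pmulr_lge0 // nv_prev.
have [hb|hb] := leP 0 be; first exact: seg_inarc e Ku.
move: ha; rewrite le_eqVlt => /orP [/eqP a0|ha].
  by have := Ky Ku; have := Ky tip_K; rewrite e -a0 !dotE /=; nra.
left; have /inarcE [s [t [hs [ht ev]]]] := vtx_in 0.
have e' : u = (al * s) *v tail D q0 +v (al * t + be) *v tip D q0.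
  by rewrite e ev; apply: pt_ext => m; rewrite !dotE /=; ring.
have hs' : 0 < al * s by exact: mulr_gt0.
have [h|h] := ltP 0 (al * t + be).
  by apply/(inarcE _ (st 0)); exists (al * s), (al * t + be).
exfalso; apply: tail_out.
have -> : tail D q0 = (al * s)^-1 *v (1 *v u +v (- (al * t + be)) *v tip D q0).
  by apply: pt_ext => m; rewrite e' !dotE; field; rewrite !gt_eqF.
by apply: KZ; rewrite ?invr_gt0 //; apply: K_comb => //; lra.
Qed.

Lemma wall k u : K u -> dot (nv k) u = 0 -> ((0 < k)%N -> 0 <= dot (nv k.-1) u) ->
  0 <= dot (nv k.+1) u -> inarc D (st k).1 u \/ inarc D (st k.+1).1 u.
Proof.
case: k => [|k] Ku h0 h1 h2; first exact: wall0.
have [al [be [ha hb e]]] := wall_mid h0 (h1 isT) h2.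
exact: seg_inarc e Ku.
Qed.

(** The polygon is convex so far. The strict clause for the starting point is what later leaves room
    near it inside the pocket. *)
Definition invA j := (forall k l, (k <= j)%N -> (l <= j)%N -> 0 <= dot (nv k) (vtx l)) /\
  (forall k, (0 < k)%N -> (k <= j)%N -> 0 < dot (nv k) (vtx 0)).

(* The chain has started to spiral: the line of its last arc [j] meets an earlier
   segment [i] at [w], so that the chain can no longer reach the boundary of [K]. *)
Definition invB j := exists i A B w, [/\ (i.+1 < j)%N, 0 < A, 0 <= B,
  w = A *v vtx i +v B *v vtx i.+1 &
  [/\ dot (nv j) w = 0, forall k, (k <= j)%N -> 0 <= dot (nv k) w &
  forall k l, (k <= j)%N -> (i < l)%N -> (l <= j)%N -> 0 <= dot (nv k) (vtx l)]].

Definition distinct_arcs j := forall k l, (k <= j)%N -> (l <= j)%N -> (st k).1 = (st l).1 -> k = l.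

Definition in_K j := forall l, (l <= j)%N -> K (vtx l).

(** Otherwise arc [j] would leave the convex region through some side [l]. The exit point is
    interior to arc [j] and to arc [l] or [l.+1], so these coincide, against the distinctness of the
    arcs. *)
Lemma stepA_ge0 j : invA j -> distinct_arcs j -> in_K j.+1 ->
  forall k, (k <= j)%N -> 0 <= dot (nv k) (vtx j.+1).
Proof.
move=> [h1 _] hd hK; apply: contrapT => hn.
have [k hk hlt] : exists2 k, (k <= j)%N & dot (nv k) (vtx j.+1) < 0.
  apply: contrapT => hne; apply: hn => k hk; rewrite leNgt; apply/negP => h.
  by apply: hne; exists k.
have [t [t0 t1 hge [l [hl hl1 hl2]]]] :=
  first_exit (N := nv) (u := vtx j) (fun k hk => h1 k j hk (leqnn j)) (ex_intro2 _ _ k hk hlt).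
set p := _ +v _ in hge hl2.
have lj : (l.+1 < j)%N.
  rewrite ltnNge; apply/negP => hjl.
  have [e|e] : l = j \/ j = l.+1 by lia.
    by move: hl1; rewrite e nv_vtxS ltxx.
  by move: hl1; rewrite e; have := nv_next l; lra.
have Kp : K p by apply: K_comb; [lra|lra|lra|apply: hK|apply: hK].
have hp : inarc D (st j).1 p by apply: comb_inarc; lra.
have [hq|hq] : inarc D (st l).1 p \/ inarc D (st l.+1).1 p.
  by apply: wall => // [_|]; apply: hge; lia.
  by have := hd l j hl (leqnn j) (inarc_inj SD hq hp); lia.
by have := hd l.+1 j (ltnW lj) (leqnn j) (inarc_inj SD hq hp); lia.
Qed.

(** The previous vertex is strictly on the positive side of the arc it leads to; the reversed arc
    would have the opposite positive side. *)
Lemma same_direction j k : 0 <= dot (nv k) (vtx j) -> (st j.+1).1 = (st k).1 -> st j.+1 = st k.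
Proof.
move=> h e.
have [//|e'] : st j.+1 = st k \/ st j.+1 = flip (st k).
  move: e; case: (st j.+1) (st k) => [a ea] [b eb] /= ->; rewrite /flip /=.
  by case: ea eb => [] []; auto.
exfalso; have := nv_prev j; rewrite /nv e' nrm_flip -/(nv k); lra.
Qed.

(** The values of [nv j.+1] at the ends of side [i] are of opposite sign; weighting each end by the
    value at the other one gives the point [w] where the new plane cuts that side. *)
Lemma make_invB j i : (i < j)%N -> (forall k, (k <= j)%N -> 0 <= dot (nv k) (vtx j.+1)) ->
  (forall k l, (k <= j)%N -> (i <= l)%N -> (l <= j)%N -> 0 <= dot (nv k) (vtx l)) ->
  dot (nv j.+1) (vtx i) <= 0 ->
  (forall l, (i < l)%N -> (l <= j)%N -> 0 < dot (nv j.+1) (vtx l)) -> invB j.+1.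
Proof.
move=> hij hnew hge hi hpos.
have hp := hpos i.+1 (ltnSn i) hij.
exists i, (dot (nv j.+1) (vtx i.+1)), (- dot (nv j.+1) (vtx i)),
  (dot (nv j.+1) (vtx i.+1) *v vtx i +v (- dot (nv j.+1) (vtx i)) *v vtx i.+1).
split => //; first lra.
split.
- by rewrite !dotE; lra.
- move=> k; rewrite leq_eqVlt => /orP [/eqP ->|hk]; first by rewrite !dotE; lra.
  rewrite !dotE addr_ge0 // mulr_ge0 //; try lra.
    by apply: hge; lia.
  by apply: hge; lia.
- move=> k l; rewrite leq_eqVlt => /orP [/eqP ->|hk] hl; rewrite leq_eqVlt => /orP [/eqP ->|hl2].
  + by rewrite nv_vtx.
  + by apply: ltW; apply: hpos.
  + exact: hnew.
  + by apply: hge => //; lia.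
Qed.

Lemma stepA j : invA j -> distinct_arcs j -> in_K j.+1 ->
  (forall k, (k <= j)%N -> 0 <= dot (nv k) (vtx j.+1)) /\ (invA j.+1 \/ invB j.+1).
Proof.
move=> hA hd hK; have hnew := stepA_ge0 hA hd hK; split => //.
case: hA => h1 h2.
have [hall|hex] := EM (forall l, (l <= j)%N -> 0 < dot (nv j.+1) (vtx l)).
  left; split.
    move=> k l; rewrite leq_eqVlt => /orP [/eqP ->|hk]; rewrite leq_eqVlt => /orP [/eqP ->|hl].
    + by rewrite nv_vtx.
    + by apply: ltW; apply: hall.
    + exact: hnew.
    + exact: h1.
  move=> k k0; rewrite leq_eqVlt => /orP [/eqP ->|hk]; first exact: hall.
  exact: h2.
right.
have [i hi hle] : exists2 i, (i <= j)%N & dot (nv j.+1) (vtx i) <= 0.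
  apply: contrapT => hne; apply: hex => l hl; rewrite ltNge; apply/negP => h.
  by apply: hne; exists l.
have [k [hik hkj hk hmax]] := last_index (P := fun i => dot (nv j.+1) (vtx i) <= 0) hi hle.
apply: (@make_invB j k) => //.
- rewrite ltn_neqAle hkj andbT; apply/eqP => e; move: hk; rewrite e.
  by have := nv_prev j; lra.
- by move=> k' l hk' _ hl; apply: h1.
- by move=> l hkl hlj; rewrite ltNge; apply/negP; apply: hmax.
Qed.

(** Arc [j] runs towards [w], which is interior to arc [i], and cannot cross it there. So its tip is
    a combination of [vtx j] and [w] with nonnegative coefficients, and convexity keeps it in [K]
    and behind no wall. *)
Lemma stepB j : invB j -> distinct_arcs j -> in_K j ->
  [/\ K (vtx j.+1), forall k, (k <= j)%N -> 0 <= dot (nv k) (vtx j.+1) & invB j.+1].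
Proof.
move=> [i [A [B [w [hij hA hB ew [hw0 hw1 hv]]]]]] hd hK.
have Kw : K w by rewrite ew; apply: K_comb; [lra|lra|lra|apply: hK; lia|apply: hK; lia].
have [al [be e]] := nv_span hw0.
have [j' ej] : exists j', j = j'.+1 by exists j.-1; lia.
have hbe : 0 <= be.
  have := hw1 j' _; rewrite ej => /(_ (leqnSn _)).
  rewrite e ej !dotE nv_vtxS mulr0 add0r pmulr_lge0 //; exact: nv_next.
have hal : al <= 0.
  rewrite leNgt; apply/negP => hal.
  have h1 : inarc D (st j).1 w by rewrite e; apply: comb_inarc.
  have h2 : inarc D (st i).1 w by rewrite ew; apply: comb_inarc.
  by have := hd i j _ (leqnn j) (inarc_inj SD h2 h1); lia.
have Kj : K (vtx j) by apply: hK.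
have hbe' : 0 < be.
  move: hbe; rewrite le_eqVlt => /orP [/eqP b0|//].
  by have := Ky Kw; have := Ky Kj; rewrite e -b0 !dotE; nra.
have ev : vtx j.+1 = be^-1 *v (1 *v w +v (- al) *v vtx j).
  by apply: pt_ext => m; rewrite e !dotE; field; rewrite gt_eqF.
have ib : 0 < be^-1 by rewrite invr_gt0.
have hK1 : K (vtx j.+1) by rewrite ev; apply: KZ => //; apply: K_comb => //; lra.
have hnew k : (k <= j)%N -> 0 <= dot (nv k) (vtx j.+1).
  move=> hk; rewrite ev !dotE mul1r pmulr_rge0 // addr_ge0 //; first exact: hw1.
  by apply: mulr_ge0; [lra|apply: hv => //; lia].
split => //.
have hwn : dot (nv j.+1) w <= 0.
  rewrite e !dotE nv_vtx mulr0 addr0; have := nv_prev j; nra.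
(* Since [w] is on the nonpositive side of the new plane, so is an end of side [i]; the last such
   vertex gives the side cut by the new line. *)
have [i1 [hi1 hi1']] : exists i1, (i <= i1)%N /\ (i1 <= i.+1)%N /\ dot (nv j.+1) (vtx i1) <= 0.
  have [h|h] := leP (dot (nv j.+1) (vtx i)) 0; first by exists i; rewrite leqnn leqnSn.
  exists i.+1; rewrite leqnn leqnSn; do 2!split=> //.
  by rewrite leNgt; apply/negP => h'; move: hwn; rewrite ew !dotE; nra.
have hi1j : (i1 <= j)%N by lia.
have [i' [hi' hi'j hle hmax]] :=
  last_index (P := fun i => dot (nv j.+1) (vtx i) <= 0) hi1j hi1'.2.
have ltij : (i' < j)%N.
  rewrite ltn_neqAle hi'j andbT; apply/eqP => e'; move: hle; rewrite e'.
  by have := nv_prev j; lra.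
have hpos l : (i' < l)%N -> (l <= j)%N -> 0 < dot (nv j.+1) (vtx l).
  by move=> hkl hlj; rewrite ltNge; apply/negP; apply: hmax.
have [hlt|heq] : (i < i')%N \/ i' = i by lia.
  apply: (@make_invB j i') => // k l hk hl hlj; apply: hv => //; lia.
(* The new line meets the same segment [i], closer to its front end. *)
rewrite heq in hle hpos ltij.
have hp := hpos i.+1 (ltnSn i) ltij.
set a := dot (nv j.+1) (vtx i) in hle; set b := dot (nv j.+1) (vtx i.+1) in hp.
have hab : A * a + B * b <= 0 by move: hwn; rewrite ew !dotE.
have ew' : b *v vtx i +v (- a) *v vtx i.+1 = (b / A) *v w +v (- a - b * B / A) *v vtx i.+1.
  by apply: pt_ext => m; rewrite ew !dotE; field; rewrite gt_eqF.
have c0 : 0 <= - a - b * B / A.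
  have -> : - a - b * B / A = - (A * a + B * b) / A by field; rewrite gt_eqF.
  by apply: divr_ge0; [lra|exact: ltW].
exists i, b, (- a), (b *v vtx i +v (- a) *v vtx i.+1); split => //; first lra.
split.
- by rewrite !dotE -/a -/b; ring.
- move=> k; rewrite leq_eqVlt => /orP [/eqP ->|hk]; first by rewrite !dotE -/a -/b; lra.
  rewrite ew' !dotE addr_ge0 // mulr_ge0 //; first by rewrite divr_ge0 // ltW.
    exact: hw1.
  by apply: hv => //; lia.
- move=> k l; rewrite leq_eqVlt => /orP [/eqP ->|hk] hl; rewrite leq_eqVlt => /orP [/eqP ->|hl2].
  + by rewrite nv_vtx.
  + by apply: ltW; apply: hpos.
  + exact: hnew.
  + exact: hv.
Qed.

Definition pocket m := [/\ (0 < m)%N, invA m, in_K m & ~ K (vtx m.+1)].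

Definition loop k m := [/\ (k <= m)%N, st m.+1 = st k, distinct_arcs m & in_K m.+1].

Lemma distinct_arcsS j : distinct_arcs j -> (forall k, (k <= j)%N -> (st j.+1).1 <> (st k).1) ->
  distinct_arcs j.+1.
Proof.
move=> hd hn k l; rewrite leq_eqVlt => /orP [/eqP ->|hk]; rewrite leq_eqVlt => /orP [/eqP ->|hl] //.
- by move=> e; case: (hn l hl).
- by move=> e; case: (hn k hk).
- exact: hd.
Qed.

(** With neither a return nor an exit, one of the two invariants would hold forever and the arcs of
    the chain would stay distinct, though there are only [n]. *)
Lemma chain_dichotomy : (exists k m, loop k m) \/ (exists m, pocket m).
Proof.
apply: contrapT => hno.
have nol k m : ~ loop k m by move=> h; apply: hno; left; exists k, m.
have nop m : ~ pocket m by move=> h; apply: hno; right; exists m.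
have H j : [/\ distinct_arcs j.+1, in_K j.+1 & invA j.+1 \/ invB j.+1].
  elim: j => [|j [hd hK hI]].
    have K1 : in_K 1 by case=> [|[|//]].
    split => //.
      apply: distinct_arcsS => [k l|k].
        by rewrite !leqn0 => /eqP -> /eqP ->.
      rewrite leqn0 => /eqP -> e; have := vtx_in 1; rewrite e; exact: tip_notin.
    left; split.
      case=> [|[|//]] [|[|//]] _ _; rewrite ?nv_vtx ?nv_vtxS //.
      exact: ltW (nv_prev 0).
    by case=> [|[|//]] // _ _; apply: (nv_prev 0).
  have [hK2 hnew hI2] : [/\ in_K j.+2, forall k, (k <= j.+1)%N -> 0 <= dot (nv k) (vtx j.+2)
      & invA j.+2 \/ invB j.+2].
    case: hI => hI.
      have K2 : in_K j.+2.
        move=> l; rewrite leq_eqVlt => /orP [/eqP ->|hl]; last exact: hK.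
        by apply: contrapT => hn; apply: (nop j.+1).
      by have [h1 h2] := stepA hI hd K2.
    have [h1 h2 h3] := stepB hI hd hK; split=> //; last by right.
    by move=> l; rewrite leq_eqVlt => /orP [/eqP ->|hl] //; apply: hK.
  split => //.
  apply: distinct_arcsS => // k hk e; apply: (nol k j.+1); split => //.
  apply: same_direction e; move: hk; rewrite leq_eqVlt => /orP [/eqP ->|hk]; first by rewrite nv_vtx.
  have [hA|[i [A [B [w [hij _ _ _ [_ _ hv]]]]]]] := hI.
    by case: hA => h _; apply: h => //; lia.
  by apply: hv => //; lia.
have [hd _ _] := H n.
have inj : injective (fun k : 'I_n.+2 => (st k).1).
  by move=> k l /hd h; apply: val_inj; apply: h; rewrite -ltnS.
by have := leq_card _ inj; rewrite !card_ord; lia.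
Qed.

End Chain.

(** * Swirls in a convex cone *)

(** The variant for a strict start and a weak end: the exit may occur only at [u'] itself, whence
    [t <= 1]. *)
Lemma first_exit_pos (N : nat -> pt) m u u' :
  (forall k, (k <= m)%N -> 0 < dot (N k) u) ->
  (exists2 k, (k <= m)%N & dot (N k) u' <= 0) ->
  exists t, [/\ 0 < t, t <= 1,
    forall k, (k <= m)%N -> 0 <= dot (N k) ((1 - t) *v u +v t *v u') &
    exists2 k, (k <= m)%N & dot (N k) ((1 - t) *v u +v t *v u') = 0].
Proof.
move=> hu [k0 hk0 hn].
have [hex|hno] := EM (exists2 k, (k <= m)%N & dot (N k) u' < 0).
  have [t [t0 t1 hge [k [hk _ hk0']]]] := first_exit (fun k hk => ltW (hu k hk)) hex.
  exists t; split=> //; [|exact: ltW|by exists k].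
  rewrite lt_neqAle t0 andbT; apply/eqP => e.
  by have := hu k hk; move: hk0'; rewrite -e !dotE; lra.
have e : (1 - 1) *v u +v 1 *v u' = u' by apply: pt_ext => l; rewrite !dotE; ring.
have hge k : (k <= m)%N -> 0 <= dot (N k) u'.
  by move=> hk; rewrite leNgt; apply/negP => h; apply: hno; exists k.
exists 1; rewrite e; split=> //.
by exists k0 => //; apply: le_anti; rewrite hn hge.
Qed.

(** Openness of finitely many strict inequalities, in the only form used here. *)
Lemma small_step (f g : nat -> R) m : (forall k, (k < m)%N -> 0 < f k) ->
  exists2 d, 0 < d & forall k, (k < m)%N -> 0 < f k + d * g k.
Proof.
elim: m => [|m IH] hf; first by exists 1; [lra|].
have [d d0 hd] := IH (fun k hk => hf k (ltnW hk)).
have fm := hf m (ltnSn m).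
pose d' := f m / (1 + `|g m|).
have hg : 0 < 1 + `|g m| by have := normr_ge0 (g m); lra.
have d'0 : 0 < d' by rewrite divr_gt0.
have hd' : d' * (1 + `|g m|) = f m by rewrite divfK // gt_eqF.
exists (Num.min d d'); first by rewrite lt_min d0.
have h1 : Num.min d d' <= d by rewrite ge_min lexx.
have h2 : Num.min d d' <= d' by rewrite ge_min lexx orbT.
have h0 : 0 < Num.min d d' by rewrite lt_min d0.
move=> k; rewrite ltnS leq_eqVlt => /orP [/eqP ->|hk].
  have := ler_norm (- g m); rewrite normrN => h3.
  have := normr_ge0 (g m); nra.
have := hd k hk; have := hf k (ltnW hk); set m' := Num.min _ _ in h0 h1 h2 *.
have [hgk|hgk] := leP 0 (g k); nra.
Qed.

Lemma cramer (a b c w z : pt) :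
  det3 a b c * dot z w = det3 w b c * dot z a + det3 a w c * dot z b + det3 a b w * dot z c.
Proof.
case: a b c w z => [[a1 a2] a3] [[b1 b2] b3] [[c1 c2] c3] [[w1 w2] w3] [[z1 z2] z3].
by rewrite /det3 /dot /px /py /pz /=; ring.
Qed.

Section Swirls.

Variables (n : nat) (D : 'I_n -> sarc).
Hypothesis SD : spherical_diagram D.
Notation state := ('I_n * bool)%type.

(** [swirl] hides which ends make the hits, so the condition ranges over every end that lies on the
    next arc; by [hit_end] there is only one. *)
Definition swirl_in (K : pt -> Prop) (s : seq 'I_n) := swirl D s /\
  forall a e, a \in s -> arc_interior (D (next s a)) (endpoint (D a) e) -> K (endpoint (D a) e).

Lemma arc_interior_inarc a u : arc_interior (D a) u -> inarc D a u.
Proof. by move=> [_ [s [t [hs [ht e]]]]]; exists s, t. Qed.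

(** If both ends were interior to [b], so would be their sum, which is also interior to the arc
    itself; the arc would then be [b] and contain its own end. *)
Lemma hits_once q b : inarc D b (tip D q) -> ~ inarc D b (tail D q).
Proof.
move=> h1 h2.
have e : q.1 = b.
  apply: (@inarc_inj _ _ SD _ _ (1 *v tail D q +v 1 *v tip D q)).
    by apply/inarcE; exists 1, 1; do 2!(split; first lra).
  case: h1 => s1 [t1 [hs1 [ht1 ->]]]; case: h2 => s2 [t2 [hs2 [ht2 ->]]].
  exists (s2 + s1), (t2 + t1); do 2!(split; first lra).
  by apply: pt_ext => m; rewrite !dotE; ring.
by apply: (tip_notin SD (q := q)); rewrite e.
Qed.

Lemma hit_end a b e e' : arc_interior (D b) (endpoint (D a) e) ->
  arc_interior (D b) (endpoint (D a) e') -> e = e'.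
Proof.
move=> /arc_interior_inarc h1 /arc_interior_inarc h2; apply/eqP; rewrite -[_ == _]negbK.
apply/negP => hne; apply: (@hits_once (a, e) b) => //.
rewrite /tail /other_endpoint /=.
by have -> : ~~ e = e' by move: hne; case: (e) (e') => [] [].
Qed.

Lemma cycle_swirl cw (g : nat -> state) m (K : pt -> Prop) :
  (forall i, follows D cw (g i) (g i.+1)) -> g m.+1 = g 0%N ->
  (forall i j, (i <= m)%N -> (j <= m)%N -> (g i).1 = (g j).1 -> i = j) ->
  (forall i, (i <= m)%N -> K (tip D (g i))) ->
  swirl_in K (mkseq (fun i => (g i).1) m.+1).
Proof.
move=> hf hm hinj hK; set s := mkseq _ _.
have us : uniq s.
  rewrite map_inj_in_uniq ?iota_uniq // => i j; rewrite !mem_iota /= add0n => hi hj.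
  by apply: hinj; lia.
have ns i : (i <= m)%N -> nth (g 0%N).1 s i = (g i).1 by move=> hi; rewrite nth_mkseq.
have memP a : a \in s -> exists2 i, (i <= m)%N & a = (g i).1.
  by move=> /mapP [i]; rewrite mem_iota /= add0n => hi ->; exists i.
have idx i : (i <= m)%N -> index (g i).1 s = i.
  by move=> hi; rewrite -(ns i hi) index_uniq // size_mkseq.
have nxt i : (i <= m)%N -> next s (g i).1 = (g i.+1).1.
  move=> hi; rewrite next_nth ifT; last first.
    by rewrite -(ns i hi) mem_nth // size_mkseq.
  have es : s = (g 0%N).1 :: [seq (g j).1 | j <- iota 1 m] by [].
  rewrite {1}es idx //.
  have -> : nth (g 0%N).1 [seq (g j).1 | j <- iota 1 m] i = nth (g 0%N).1 s i.+1 by rewrite es.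
  move: hi; rewrite leq_eqVlt => /orP [/eqP ->|hi]; last by rewrite ns.
  by rewrite nth_default ?size_mkseq // hm.
split; last first.
  move=> a e /memP [i hi ->]; rewrite nxt // => h.
  have [h1 _ _] := hf i; have -> : e = (g i).2 by apply: hit_end h h1.
  exact: (hK i hi).
split => //; split; first by rewrite size_mkseq.
exists (fun a => (g (index a s)).2), cw => a /memP [i hi ->].
rewrite nxt // idx //; have [h1 _ h3] := hf i; split; first exact: h1.
have -> : index (g i.+1).1 s = if i == m then 0%N else i.+1.
  case: eqP => [->|hne]; first by rewrite hm idx.
  by rewrite idx //; lia.
have -> : (g (if i == m then 0%N else i.+1)).2 = (g i.+1).2 by case: eqP => // ->; rewrite hm.
move: h3; rewrite nrmE /sg /tip /tail.
by case: (cw); rewrite ?mul1r // mulN1r oppr_gt0.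
Qed.

Variable nx : bool -> state -> state.
Hypothesis nxP : forall cw q, follows D cw q (nx cw q).

Section InCone.

Variables (K : pt -> Prop) (y : pt).
Hypothesis KD : forall u v, K u -> K v -> K (u +v v).
Hypothesis KZ : forall s u, 0 < s -> K u -> K (s *v u).
Hypothesis Ky : forall u, K u -> 0 < dot y u.
Hypothesis Kend : forall q u, inarc D q.1 u -> K u -> K (tip D q) \/ K (tail D q).

Definition enters q x := [/\ inarc D q.1 x, K x, ~ K (tail D q) & K (tip D q)].

Lemma loop_swirl cw q0 x0 k m : loop D (nx cw) K q0 x0 k m -> exists s, swirl_in K s.
Proof.
move=> [hkm he hd hK]; pose g i := st (nx cw) q0 (k + i).
exists (mkseq (fun i => (g i).1) (m - k).+1); apply: (@cycle_swirl cw).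
- by move=> i; rewrite /g addnS; apply: nxP.
- by rewrite /g addn0 addnS subnKC.
- by move=> i j hi hj /hd h; have := h ltac:(lia) ltac:(lia); lia.
- by move=> i hi; apply: (hK (k + i).+1); lia.
Qed.

(** * Pockets and their growth *)

Definition inside cw q0 m u := K u /\ forall k, (k <= m)%N -> 0 < dot (nv D cw (nx cw) q0 k) u.

Definition meets cw q0 m : {set 'I_n} := [set a | `[< exists2 u, inarc D a u & inside cw q0 m u >]].

Notation pocketed cw q0 x0 m := (pocket D cw (nx cw) K q0 x0 m).

(** The counterpart of [wall0] at the other end of the chain: with [al <= 0] the exit vertex would
    be a combination of [u] and [vtx m] with nonnegative coefficients and would lie in [K]. *)
Lemma last_wall cw q0 x0 m u : enters q0 x0 -> pocketed cw q0 x0 m -> K u ->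
  dot (nv D cw (nx cw) q0 m) u = 0 -> 0 <= dot (nv D cw (nx cw) q0 m.-1) u ->
  exists al be, [/\ 0 < al, 0 <= be & u = al *v vtx D (nx cw) q0 x0 m +v be *v vtx D (nx cw) q0 x0 m.+1].
Proof.
move=> [hx hKx htl htp] [m0 hA hK hout] Ku h0 h1.
have [al [be e]] := nv_span SD (nxP cw) hx h0.
have hb : 0 <= be.
  move: h1; rewrite e !dotE; case: m m0 {hA hK hout h0 e} => // m _ /=.
  by rewrite nv_vtxS // mulr0 add0r pmulr_lge0 //; apply: (nv_next (nxP cw)).
exists al, be; split => //.
have Km := hK m (leqnn m); have ym := Ky Km; have yu := Ky Ku.
rewrite ltNge; apply/negP => hal; apply: hout.
have hb' : 0 < be.
  move: hb; rewrite le_eqVlt => /orP [/eqP b0|//].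
  by move: yu; rewrite e -b0 !dotE; nra.
have -> : vtx D (nx cw) q0 x0 m.+1 = be^-1 *v (1 *v u +v (- al) *v vtx D (nx cw) q0 x0 m).
  by apply: pt_ext => l; rewrite e !dotE; field; rewrite gt_eqF.
by apply: KZ; rewrite ?invr_gt0 //; apply: (K_comb KD KZ) => //; lra.
Qed.

Lemma nrm_same_arc cw cw' q q' u : q.1 = q'.1 -> dot (nrm D cw q) u = 0 -> dot (nrm D cw' q') u = 0.
Proof.
move=> e h; have [s [t ->]] := nrm_eq0 SD h.
have [->|->] : q = q' \/ q = flip q'.
  by case: q q' e {h} => [a ea] [b eb] /= ->; rewrite /flip /=; case: ea eb => [] []; auto.
  by rewrite !dotE nrm_tip nrm_tail; ring.
by rewrite tip_flip tail_flip !dotE nrm_tip nrm_tail; ring.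
Qed.

Section PocketStep.

Variables (cw : bool) (q0 : state) (x0 : pt) (m : nat).
Hypothesis q0_enters : enters q0 x0.
Hypothesis q0_pocket : pocketed cw q0 x0 m.

Local Notation c := (st (nx cw) q0).
Local Notation v := (vtx D (nx cw) q0 x0).
Local Notation N := (nv D cw (nx cw) q0).
Local Notation q1 := (flip (c m)).
Local Notation x1 := (v m).

Lemma exit_enters : enters q1 x1.
Proof.
case: q0_enters q0_pocket => [hx hKx htl htp] [m0 hA hK hout].
have hin := vtx_in (nxP cw) hx m.
split; [exact: hin|exact: hK|by rewrite tail_flip|].
by rewrite tip_flip; case: (Kend hin (hK m (leqnn m))).
Qed.

Local Notation c' := (st (nx (~~ cw)) q1).
Local Notation v' := (vtx D (nx (~~ cw)) q1 x1).
Local Notation N' := (nv D (~~ cw) (nx (~~ cw)) q1).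

(** Reversing both the traversal and the sense of turning preserves the positive side, so both
    pockets lie on the same side of the exit arc. *)
Lemma nv_flip u : dot (N' 0) u = dot (N m) u.
Proof. by rewrite /nv /= nrmN nrm_flip opprK. Qed.

Lemma wall_arc u l : K u -> (l <= m)%N -> (forall k, (k <= m)%N -> 0 <= dot (N k) u) ->
  dot (N l) u = 0 -> exists2 k, (k <= m)%N & inarc D (c k).1 u.
Proof.
case: (q0_enters) (q0_pocket) => [hx hKx htl htp] [m0 hA hK hout] Ku hl hge h0.
move: hl; rewrite leq_eqVlt => /orP [/eqP el|hl].
  rewrite el in h0.
  have [al [be [ha hb ->]]] := last_wall q0_enters q0_pocket Ku h0 (hge _ (leq_pred m)).
  by exists m => //; apply: (comb_inarc (nxP cw)).
have [h|h] := wall SD (nxP cw) KD KZ Ky hx htl htp Ku h0 (fun _ => hge _ (leq_trans (leq_pred l) (ltnW hl)))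
  (hge _ hl).
  by exists l => //; lia.
by exists l.+1.
Qed.

(** If [p] were inside, the way from [p] back to [v' k] would leave the old pocket at a point
    interior to one of its arcs. That point is also interior to [c' k], so [c' k] is a wall of the
    pocket and [p] lies in its plane. *)
Lemma outside_seg k al be p : ~ inside cw q0 m (v' k) -> K (v' k) -> 0 <= al -> 0 <= be ->
  p = al *v v' k +v be *v v' k.+1 -> ~ inside cw q0 m p.
Proof.
move=> hn Kk ha hb ep [Kp hp].
have hex : exists2 l, (l <= m)%N & dot (N l) (v' k) <= 0.
  apply: contrapT => hne; apply: hn; split => // l hl; rewrite ltNge; apply/negP => h.
  by apply: hne; exists l.
have [t [t0 t1 hge [l hl hl0]]] := first_exit_pos hp hex.
set p' := _ +v _ in hge hl0.
have Kp' : K p' by apply: (K_comb KD KZ) => //; lra.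
have [j hj hin] := wall_arc Kp' hl hge hl0.
have [hx1 _ _ _] := exit_enters.
have hin' : inarc D (c' k).1 p'.
  have -> : p' = ((1 - t) * al + t) *v v' k +v ((1 - t) * be) *v v' k.+1.
    by rewrite /p' ep; apply: pt_ext => i; rewrite !dotE; ring.
  apply: (comb_inarc (nxP (~~ cw)) hx1); last by apply: mulr_ge0; lra.
  by apply: ltr_wpDl => //; apply: mulr_ge0; lra.
have e := inarc_inj SD hin' hin.
have h' : dot (nrm D cw (c' k)) p = 0.
  rewrite ep !dotE (nrm_inarc _ (vtx_in (nxP (~~ cw)) hx1 k)).
  by rewrite /= nrm_tip; ring.
by have := hp j hj; rewrite /nv (nrm_same_arc _ e h') ltxx.
Qed.

(** The new walls never enter the old pocket, so no way inside the old pocket can leave the new one.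
    This gives inclusion; the growth is strict because the arc before the exit arc, only a wall of
    the old pocket, meets the interior of the new one. *)
Lemma pocket_grows m' : pocketed (~~ cw) q1 x1 m' ->
  (#|meets cw q0 m| < #|meets (~~ cw) q1 m'|)%N.
Proof.
move=> hp'; have hent := exit_enters.
case: (q0_enters) (q0_pocket) => [hx hKx htl htp] [m0 hA hK hout].
case: (hent) (hp') => [hx1 hKx1 htl1 htp1] [m0' hA' hK' hout'].
have [m1 em] : exists m1, m = m1.+1 by exists m.-1; lia.
have out k : (0 < k)%N -> (k <= m')%N -> ~ inside cw q0 m (v' k).
  elim: k => [//|[|k] IH] _ hk.
    by move=> [_ /(_ m (leqnn m))]; rewrite /= tip_flip nrm_tail ltxx.
  apply: (@outside_seg k.+1 0 1); [apply: IH; lia|apply: hK'; lia|lra|lra|].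
  by apply: pt_ext => i; rewrite !dotE; ring.
have xpos k : (k < m')%N -> 0 < dot (N' k.+1) x1 by move=> hk; apply: (hA'.2 k.+1).
(* [b] is a point of the arc [c m1] just before [x1], on the boundary of the old pocket and strictly
   inside the new one. *)
have [d d0 hd] := small_step (fun k => dot (N' k.+1) (v m1)) xpos.
pose b := d *v v m1 +v 1 *v x1.
have Kb : K b by apply: (K_comb KD KZ); [lra|lra|lra|apply: hK; lia|apply: hK].
have Nb k : (k <= m)%N -> 0 <= dot (N k) b.
  move=> hk; rewrite !dotE; have h1 := hA.1 k m hk (leqnn m).
  have h2 : 0 <= dot (N k) (v m1) by apply: (hA.1 k m1 hk); lia.
  by apply: addr_ge0; apply: mulr_ge0 => //; lra.
have N'b k : (k <= m')%N -> 0 < dot (N' k) b.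
  case: k => [|k] hk; last by have := hd k hk; rewrite !dotE mul1r addrC.
  rewrite nv_flip !dotE nv_vtx // mulr0 addr0 mulr_gt0 //.
  by rewrite em; apply: (nv_prev (nxP cw)).
have sub u : inside cw q0 m u -> inside (~~ cw) q1 m' u.
  move=> hu; split; first exact: hu.1.
  apply: contrapT => hno.
  have hex : exists2 k, (k <= m')%N & dot (N' k) u <= 0.
    apply: contrapT => hne; apply: hno => k hk; rewrite ltNge; apply/negP => h.
    by apply: hne; exists k.
  have [et et0 het] := small_step (m := m'.+1) (f := fun k => dot (N' k) b)
    (fun k => dot (N' k) u) (fun k hk => N'b k hk).
  (* Pushing [b] slightly towards [u] makes it interior to both pockets. *)
  pose b' := 1 *v b +v et *v u.
  have N'b' k : (k <= m')%N -> 0 < dot (N' k) b'.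
    by move=> hk; have := het k hk; rewrite [dot _ b']dotD !dotZ mul1r.
  have [t [t0 t1 hge [k hk hk0]]] := first_exit_pos N'b' hex.
  set p := _ +v _ in hge hk0.
  have hp : inside cw q0 m p.
    split; first by apply: (K_comb KD KZ); [lra|lra|lra|
      apply: (K_comb KD KZ); [lra|lra|lra|done|exact: hu.1]|exact: hu.1].
    move=> l hl; have h1 := Nb l hl; have h2 := hu.2 l hl.
    rewrite /p dotD !dotZ [dot _ b']dotD !dotZ mul1r.
    have h3 : 0 < et * dot (N l) u by exact: mulr_gt0.
    by nra.
  case: k hk hk0 => [|k] hk hk0.
    by move: hk0; rewrite nv_flip; have := hp.2 m (leqnn m); lra.
  have Kp := hp.1.
  have [al [be [ha hb ep]]] : exists al be, [/\ 0 <= al, 0 <= be &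
      p = al *v v' k.+1 +v be *v v' k.+2].
    move: (hk); rewrite leq_eqVlt => /orP [/eqP ek|hk'].
      have [al [be [ha hb ep]]] := last_wall (m := m') hent hp' Kp ltac:(by rewrite -ek)
        (hge _ (leq_pred m')).
      by exists al, be; split; [exact: ltW| |rewrite ek].
    by apply: (wall_mid SD (nxP (~~ cw)) hx1 hk0); apply: hge => //; lia.
  have Kk : K (v' k.+1) by apply: hK'.
  by apply: (outside_seg (out k.+1 isT hk) Kk ha hb ep).
apply: proper_card; apply/properP; split.
  apply/subsetP => a; rewrite !inE => /asboolP [u hu1 hu2]; apply/asboolP; exists u => //.
  exact: sub.
exists (c m1).1.
  rewrite inE; apply/asboolP; exists b; last by split.
  by rewrite /b em; apply: (comb_inarc (nxP cw)) => //; lra.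
rewrite inE; apply/negP => /asboolP [u hu [_ /(_ m1)]].
by rewrite /nv (nrm_inarc _ hu) ltxx em => /(_ (leqnSn m1)).
Qed.

End PocketStep.

(** Without a swirl every entering arc yields a pocket, and every pocket a larger one of the
    opposite sense; after [n.+1] steps it would meet more than [n] arcs. *)
Lemma enters_swirl q0 x0 : enters q0 x0 -> exists s, swirl_in K s.
Proof.
move=> h0; apply: contrapT => hno.
have get cw' q x : enters q x -> exists m, pocketed cw' q x m.
  move=> [h1 h2 h3 h4].
  have [[k [m h]]|//] := chain_dichotomy SD (nxP cw') KD KZ Ky h1 h2 h3 h4.
  by case: hno; apply: loop_swirl h.
have H k : exists cw q x m, [/\ enters q x, pocketed cw q x m & (k <= #|meets cw q m|)%N].
  elim: k => [|k [cw' [q [x [m [h1 h2 h3]]]]]].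
    by have [m hm] := get true q0 x0 h0; exists true, q0, x0, m.
  have h1' := exit_enters h1 h2; have [m' hm'] := get (~~ cw') _ _ h1'.
  by exists (~~ cw'), (flip (st (nx cw') q m)), (vtx D (nx cw') q x m), m'; split=> //;
    apply: leq_ltn_trans h3 (pocket_grows h1 h2 hm').
have [cw' [q [x [m [_ _ h]]]]] := H n.+1.
by have := leq_trans h (max_card _); rewrite card_ord ltnn.
Qed.

End InCone.

End Swirls.

(** * Cones spanned by signed poles *)

Section PoleCone.

Variables (n : nat) (D : 'I_n -> sarc).
Hypothesis SD : spherical_diagram D.
Notation state := ('I_n * bool)%type.

(* On the unit sphere, a point strictly between two others has a larger value of [y]
   than the smaller of the two. *)
Lemma no_trapped_tips (V : pred state) y :
  (exists q, V q) -> (forall q, V q -> 0 < dot y (tip D q)) ->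
  (forall q q', V q -> inarc D q'.1 (tip D q) -> V q') -> False.
Proof.
move=> [q0 V0] hy hV.
case: (arg_minP (fun q => dot y (tip D q)) V0) => q Vq hmin.
have [q' [_ hin _]] := follows_exists SD true q.
have V1 := hV q q' Vq hin; have V2 := hV q (flip q') Vq hin.
have h1 := hmin _ V1; have h2 := hmin _ V2; have h0 := hy q Vq.
have /inarcE [s [t [hs [ht e]]]] := hin.
have hlt : dot (tail D q') (tip D q') < 1.
  apply: unit_dot_lt1 (tail_sphere SD q') (tip_sphere SD q') _ => e'.
  have := state_indep SD q'; rewrite e' dot_cross /det3 /cross /px /py /pz /=.
  by move/eqP; apply; ring.
have hst : 1 < s + t.
  have := tip_sphere SD q; rewrite /on_sphere e !(dotD, dotZ, dotZl, dotDl).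
  rewrite (tail_sphere SD q') (tip_sphere SD q') (dotC (tip _ _) (tail _ _)) => h.
  rewrite ltNge; apply/negP => hle.
  have : 0 < s * t by exact: mulr_gt0.
  by nra.
rewrite tip_flip in h2; have := congr1 (dot y) e; rewrite !dotE => ey.
have p1 : 0 <= s * (dot y (tail D q') - dot y (tip D q)) by apply: mulr_ge0; lra.
have p2 : 0 <= t * (dot y (tip D q') - dot y (tip D q)) by apply: mulr_ge0; lra.
have p3 : 0 < (s + t - 1) * dot y (tip D q) by apply: mulr_gt0; lra.
lra.
Qed.

Variables (k : nat) (w : 'I_k -> pt) (fa : 'I_n -> 'I_k) (hd : 'I_n -> bool) (y : pt).
Hypothesis hdP : forall a, exists s t, [/\ 0 < s, 0 < t &
  tip D (a, hd a) = s *v tail D (a, hd a) +v t *v w (fa a)].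
Hypothesis yw : forall i, 0 < dot y (w i).

(** The cone generated by the [w i] in dual form: every functional that is nonnegative on the
    generators is nonnegative on [u]. The clause on [y] removes the apex. *)
Definition pole_cone u := 0 < dot y u /\ forall m, (forall i, 0 <= dot m (w i)) -> 0 <= dot m u.

Lemma advance a u : inarc D a u -> exists s t, [/\ 0 < s, 0 < t &
  tip D (a, hd a) = s *v u +v t *v w (fa a)].
Proof.
move=> /(inarcE _ (a, hd a)) [s1 [t1 [hs1 [ht1 ->]]]].
have [s [t [hs ht e]]] := hdP a.
have h : 0 < s1 + t1 * s by have := mulr_gt0 ht1 hs; lra.
exists (s / (s1 + t1 * s)), (t * s1 / (s1 + t1 * s)); split.
- exact: divr_gt0.
- by apply: divr_gt0 => //; apply: mulr_gt0.
apply: pt_ext => m; have := congr1 (dot m) e; rewrite !dotE => em.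
have -> : dot m (tail D (a, hd a)) = (dot m (tip D (a, hd a)) - t * dot m (w (fa a))) / s.
  by rewrite em; field; rewrite gt_eqF.
by field; rewrite !gt_eqF.
Qed.

(** If all ends had [y < 0], the diagram would lie in an open hemisphere. If all had [y <= 0] and
    one had [y = 0], its blocker and the next one would lie in the plane [y = 0]; the turn between
    them is not flat, so [y] would vanish. *)
Lemma positive_tip (a0 : 'I_n) : exists q, 0 < dot y (tip D q).
Proof.
apply: contrapT => hno.
have hle q : dot y (tip D q) <= 0 by rewrite leNgt; apply/negP => h; apply: hno; exists q.
have hle' q : dot y (tail D q) <= 0 by rewrite -tip_flip.
have zero q q' : dot y (tip D q) = 0 -> inarc D q'.1 (tip D q) ->
    dot y (tail D q') = 0 /\ dot y (tip D q') = 0.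
  move=> h0 /inarcE [s [t [hs [ht e]]]]; move: h0; rewrite e !dotE => h0.
  by have := hle q'; have := hle' q'; split; nra.
have [[q hq]|hnz] := EM (exists q, dot y (tip D q) = 0).
  have [q1 [_ hin1 _]] := follows_exists SD true q.
  have [q2 [_ hin2 hturn]] := follows_exists SD true q1.
  have [z1 z2] := zero _ _ hq hin1; have [z3 z4] := zero _ _ z2 hin2.
  have hdet : det3 (tail D q1) (tip D q1) (tip D q2) != 0.
    by apply/eqP => h; move: hturn; rewrite nrmE h mulr0 ltxx.
  have := cramer (tail D q1) (tip D q1) (tip D q2) (w (fa a0)) y.
  rewrite z1 z2 z4 !mulr0 !addr0 => /eqP; rewrite mulf_eq0 (negbTE hdet) /= => /eqP h.
  by have := yw (fa a0); rewrite h ltxx.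
apply: (@no_trapped_tips predT ((-1) *v y)) => //; first by exists (a0, true).
move=> q _; rewrite dotZl mulN1r oppr_gt0 lt_neqAle hle andbT.
by apply/eqP => h; apply: hnz; exists q.
Qed.

(** Going from head to blocker to head adds a positive multiple of a signed pole each time. On a
    period this reads [T a = s *v T a +v z] with [z] in the cone, and [s < 1] since [y] is positive
    on [T a] and on [z]; thus [T a] is a positive multiple of [z]. *)
Lemma tip_in_cone (a0 : 'I_n) : exists q, pole_cone (tip D q).
Proof.
have [q0 h0] := positive_tip a0.
have [nx nxP] := choice (follows_exists SD true).
pose g a := (nx (a, hd a)).1; pose T a := tip D (a, hd a).
have adv a : exists s t, [/\ 0 < s, 0 < t & T (g a) = s *v T a +v t *v w (fa (g a))].
  by case: (nxP (a, hd a)) => _ /advance [s [t h]] _; exists s, t.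
have [b hb] : exists b, 0 < dot y (T b).
  exists (nx q0).1; case: (nxP q0) => _ /advance [s [t [hs ht e]]] _.
  rewrite /T e !dotE; have := mulr_gt0 hs h0; have := mulr_gt0 ht (yw (fa (nx q0).1)); lra.
have pos i : 0 < dot y (T (iter i g b)).
  elim: i => [//|i IH] /=; have [s [t [hs ht ->]]] := adv (iter i g b).
  by rewrite !dotE; have := mulr_gt0 hs IH; have := mulr_gt0 ht (yw (fa (g (iter i g b)))); lra.
have [i [j [hij eij]]] : exists i j, (i < j)%N /\ iter i g b = iter j g b.
  apply: contrapT => hno.
  have inj : injective (fun i : 'I_n.+1 => iter i g b).
    move=> i j e; apply: val_inj; apply: contrapT => hne; apply: hno.
    have [h|h] : (i < j)%N \/ (j < i)%N by move: hne => /=; lia.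
      by exists i, j.
    by exists j, i.
  by have := leq_card _ inj; rewrite !card_ord ltnn.
pose a := iter i g b; have ha : 0 < dot y (T a) by apply: pos.
have shift l : exists s z, [/\ 0 < s, T (iter l.+1 g a) = s *v T a +v z, 0 < dot y z &
    forall m, (forall i, 0 <= dot m (w i)) -> 0 <= dot m z].
  elim: l => [|l [s [z [hs e hz hz']]]] /=.
    have [s [t [hs ht ->]]] := adv a; exists s, (t *v w (fa (g a))); split => //.
      by rewrite dotZ mulr_gt0.
    by move=> m hm; rewrite dotZ mulr_ge0 // ltW.
  have [s' [t [hs' ht e']]] := adv (iter l.+1 g a).
  exists (s' * s), (s' *v z +v t *v w (fa (g (iter l.+1 g a)))); split.
  - by apply: mulr_gt0.
  - by rewrite -/(iter l.+1 g a) e' e; apply: pt_ext => m; rewrite !dotE; ring.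
  - by rewrite !dotE addr_gt0 // mulr_gt0.
  - by move=> m hm; rewrite !dotE addr_ge0 // mulr_ge0 // ?hz' // ltW.
have per : iter (j - i.+1).+1 g a = a.
  by rewrite /a -iterD eij; have -> : ((j - i.+1).+1 + i)%N = j by lia.
have [s [z [hs e hz hz']]] := shift (j - i.+1)%N; rewrite per in e.
exists (a, hd a); split=> [//|m hm]; rewrite -/(T a).
have ey := congr1 (dot y) e; have em := congr1 (dot m) e; rewrite !dotE in ey em.
have s1 : s < 1 by nra.
by have := hz' m hm; nra.
Qed.

(** If no arc enters the cone, an arc hit at a point of the cone has both ends in it; the ends in
    the cone then form a trapped set, which is impossible in an open hemisphere. *)
Lemma cone_swirl (nx : bool -> state -> state) :
  (forall cw q, follows D cw q (nx cw q)) -> (0 < n)%N -> exists s, swirl_in D pole_cone s.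
Proof.
move=> nxP n0; have [q0 hq0] := tip_in_cone (Ordinal n0).
have KD u v : pole_cone u -> pole_cone v -> pole_cone (u +v v).
  move=> [h1 h2] [h3 h4]; split; first by rewrite dotD addr_gt0.
  by move=> m hm; rewrite dotD addr_ge0 // ?h2 ?h4.
have KZ s u : 0 < s -> pole_cone u -> pole_cone (s *v u).
  move=> hs [h1 h2]; split; first by rewrite dotZ mulr_gt0.
  by move=> m hm; rewrite dotZ mulr_ge0 // ?h2 // ltW.
have Ky u : pole_cone u -> 0 < dot y u by case.
have Kend q u : inarc D q.1 u -> pole_cone u -> pole_cone (tip D q) \/ pole_cone (tail D q).
  move=> hin [h1 h2].
  have hK : pole_cone (tip D (q.1, hd q.1)).
    have [s [t [hs ht ->]]] := advance hin; split.
      by rewrite !dotE addr_gt0 // mulr_gt0.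
    by move=> m hm; rewrite !dotE addr_ge0 // mulr_ge0 // ?h2 // ltW.
  case: q hK {hin} => a e; case: (hd a) e => -[] /=; auto.
have [[q [x hqx]]|hno] := EM (exists q x, enters D pole_cone q x).
  exact: (enters_swirl SD nxP KD KZ Ky Kend hqx).
exfalso; apply: (@no_trapped_tips (fun q => `[< pole_cone (tip D q) >]) y).
- by exists q0; apply/asboolP.
- by move=> q /asboolP [].
- move=> q q' /asboolP hK hin; apply/asboolP; apply: contrapT => hn.
  apply: hno; exists (flip q'), (tip D q); split=> //; first by rewrite tail_flip.
  by rewrite tip_flip; case: (Kend q' _ hin hK).
Qed.

End PoleCone.

(** Over the two ends of the arc the pole has coefficients of opposite signs, as neither it nor its
    antipode is on the closed arc. These signs and the sign of [r] decide which end is the head. *)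
Lemma oriented_head n k (D : 'I_n -> sarc) (P : 'I_k -> pt) f (r : 'I_k -> R) :
  spherical_diagram D -> oriented D P f -> (forall i, r i != 0) -> forall a, exists e s t,
  [/\ 0 < s, 0 < t & tip D (a, e) = s *v tail D (a, e) +v t *v (r (f a) *v P (f a))].
Proof.
move=> SD [hP [_ [_ hf]]] hr a; case: (hf a) => hdet [h1 h2].
have [s [t e]] := coplanar_span (state_indep SD (a, true)) hdet.
rewrite /tail /tip /other_endpoint /endpoint /= in e.
have hn1 : ~ (0 <= s /\ 0 <= t).
  by move=> [hs ht]; apply: h1; split; [exact: hP|exists s, t].
have hn2 : ~ (s <= 0 /\ t <= 0).
  move=> [hs ht]; apply: h2; split; first exact: on_sphereN.
  exists (- s), (- t); do 2!(split; first lra).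
  by apply: pt_ext => m; rewrite e !dotE; ring.
have [[hs ht]|[hs ht]] : (s < 0 /\ 0 < t) \/ (0 < s /\ t < 0).
  have [hs|hs|hs] := ltgtP s 0; have [ht|ht|ht] := ltgtP t 0; try (by [left|right]);
  by exfalso; (apply: hn1; split; lra) || (apply: hn2; split; lra).
- have s0 : s != 0 by apply/eqP; lra.
  have t0 : t != 0 by apply/eqP; lra.
  have [hr0|hr0] : 0 < r (f a) \/ r (f a) < 0.
    by have := hr (f a); case: ltgtP => //; auto.
  + exists true, (- s / t), (t^-1 / r (f a)); split.
    * by apply: divr_gt0 => //; lra.
    * by apply: divr_gt0; rewrite ?invr_gt0.
    * rewrite /tail /tip /other_endpoint /endpoint /= e.
      by apply: pt_ext => m; rewrite !dotE; field; rewrite ?hr ?s0 ?t0.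
  + exists false, (t / - s), (s^-1 / r (f a)); split.
    * by apply: divr_gt0 => //; lra.
    * by rewrite -mulrNN -invrN -invrN; apply: divr_gt0; rewrite ?invr_gt0; lra.
    * rewrite /tail /tip /other_endpoint /endpoint /= e.
      by apply: pt_ext => m; rewrite !dotE; field; rewrite ?hr ?s0 ?t0.
- have s0 : s != 0 by apply/eqP; lra.
  have t0 : t != 0 by apply/eqP; lra.
  have [hr0|hr0] : 0 < r (f a) \/ r (f a) < 0.
    by have := hr (f a); case: ltgtP => //; auto.
  + exists false, (- t / s), (s^-1 / r (f a)); split.
    * by apply: divr_gt0 => //; lra.
    * by apply: divr_gt0; rewrite ?invr_gt0.
    * rewrite /tail /tip /other_endpoint /endpoint /= e.
      by apply: pt_ext => m; rewrite !dotE; field; rewrite ?hr ?s0 ?t0.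
  + exists true, (s / - t), (t^-1 / r (f a)); split.
    * by apply: divr_gt0 => //; lra.
    * by rewrite -mulrNN -invrN -invrN; apply: divr_gt0; rewrite ?invr_gt0; lra.
    * rewrite /tail /tip /other_endpoint /endpoint /= e.
      by apply: pt_ext => m; rewrite !dotE; field; rewrite ?hr ?s0 ?t0.
Qed.

Lemma separated_swirls n (D : 'I_n -> sarc) (K1 K2 : pt -> Prop) h s1 s2 :
  spherical_diagram D -> swirl_in D K1 s1 -> swirl_in D K2 s2 ->
  (forall u, K1 u -> 0 <= dot h u) -> (forall u, K2 u -> dot h u <= 0) ->
  (exists u, dot h u != 0) -> ~ swirl_equiv s1 s2.
Proof.
move=> SD [[us [s0 [e [cw hsw]]]] hK1] [_ hK2] h1 h2 [u hu] [k ek].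
have hz a : a \in s1 -> dot h (endpoint (D a) (e a)) = 0.
  move=> ha; have [hh _] := hsw a ha; apply: le_anti.
  apply/andP; split; last by apply: h1; apply: hK1 hh.
  by apply: h2; apply: (hK2 a); rewrite ek ?mem_rot // next_rot.
have [a ha] : exists a, a \in s1 by case: (s1) s0 => // a s' _; exists a; rewrite mem_head.
have hb : next s1 a \in s1 by rewrite mem_next.
set b := next s1 a in hb; have hc : next s1 b \in s1 by rewrite mem_next.
set c := next s1 b in hc.
have [/arc_interior_inarc /(inarcE _ (b, e b)) [s [t [hs [ht ea]]]] _] := hsw a ha.
have [_ turn] := hsw b hb.
have za := hz a ha; have zb := hz b hb; have zc := hz c hc.
(* Arc [b] has two points in the plane of [h], its own hit point and that of [a], so its tail is
   there too; the turn at [c] then forces [h = 0]. *)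
have zt : dot h (other_endpoint (D b) (e b)) = 0.
  have := congr1 (dot h) ea; rewrite za !dotE /tip /tail /= zb mulr0 addr0.
  by move/esym/eqP; rewrite mulf_eq0 gt_eqF //= => /eqP.
have := cramer (other_endpoint (D b) (e b)) (endpoint (D b) (e b)) (endpoint (D c) (e c)) u h.
rewrite zt zb zc !mulr0 !addr0 => /eqP; rewrite mulf_eq0 (negbTE hu) orbF => /eqP z.
by move: turn; rewrite /= -/c z; case: (cw); rewrite ltxx.
Qed.

(** Lets [y] and the separating [h] be prescribed by their values at three independent poles. *)
Lemma dual_basis (a b c : pt) (x1 x2 x3 : R) : det3 a b c != 0 ->
  exists h, [/\ dot h a = x1, dot h b = x2 & dot h c = x3].
Proof.
move=> hd; exists ((x1 / det3 a b c) *v cross b c +v (x2 / det3 a b c) *v cross c a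
  +v (x3 / det3 a b c) *v cross a b).
have z1 : det3 b c b = 0 by rewrite /det3; ring.
have z2 : det3 b c c = 0 by rewrite /det3; ring.
have z3 : det3 c a a = 0 by rewrite /det3; ring.
have z4 : det3 c a c = 0 by rewrite /det3; ring.
have z5 : det3 a b a = 0 by rewrite /det3; ring.
have z6 : det3 a b b = 0 by rewrite /det3; ring.
have e1 : det3 b c a = det3 a b c by rewrite /det3; ring.
have e2 : det3 c a b = det3 a b c by rewrite /det3; ring.
by split; rewrite !(dotDl, dotZl) !dot_cross ?z1 ?z2 ?z3 ?z4 ?z5 ?z6 ?e1 ?e2; field.
Qed.

(** * Five disjoint cones *)

Lemma swirl_equiv_sym n (s t : seq 'I_n) : swirl_equiv s t -> swirl_equiv t s.
Proof. by move=> [k ->]; exists (size (rot k s) - k)%N; rewrite -/(rotr k _) rotK. Qed.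

Definition by_pole (o a b c : 'I_5) (xo xa xb xc xd : R) (i : 'I_5) : R :=
  if i == o then xo else if i == a then xa else if i == b then xb
  else if i == c then xc else xd.

Lemma by_poleE (o a b c d : 'I_5) (xo xa xb xc xd : R) (x := by_pole o a b c xo xa xb xc xd) :
  uniq [:: o; a; b; c; d] -> [/\ x o = xo, x a = xa, x b = xb & x c = xc /\ x d = xd].
Proof.
rewrite /= !inE !negb_or => /and5P [/and4P [h1 h2 h3 h4] /and3P [h5 h6 h7] /andP [h8 h9] h10 _].
rewrite /x /by_pole !eqxx (eq_sym a o) (eq_sym b o) (eq_sym c o) (eq_sym d o).
rewrite (eq_sym b a) (eq_sym c a) (eq_sym d a) (eq_sym c b) (eq_sym d b) (eq_sym d c).
by rewrite (negbTE h1) (negbTE h2) (negbTE h3) (negbTE h4) (negbTE h5) (negbTE h6) (negbTE h7)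
  (negbTE h8) (negbTE h9) (negbTE h10).
Qed.

Lemma by_pole_neq0 o a b c xo xa xb xc xd : xo != 0 -> xa != 0 -> xb != 0 -> xc != 0 -> xd != 0 ->
  forall i, by_pole o a b c xo xa xb xc xd i != 0.
Proof. by move=> *; rewrite /by_pole; do 4!case: ifP => // _. Qed.

Section FiveCones.

Variables (n : nat) (D : 'I_n -> sarc) (P : 'I_5 -> pt) (f : 'I_n -> 'I_5).
Hypothesis SD : spherical_diagram D.
Hypothesis OD : oriented D P f.

Variables (o a b c d : 'I_5) (r : 'I_5 -> R).
Hypothesis rn0 : forall i, r i != 0.
Hypothesis cover : forall i, [|| i == o, i == a, i == b, i == c | i == d].
Hypothesis uniq5 : uniq [:: o; a; b; c; d].

Local Notation w i := (r i *v P i).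
Hypothesis w_o : forall m, dot m (w o) = dot m (w a) + dot m (w b).
Hypothesis w_d : forall m, dot m (w d) = - (dot m (w a) + dot m (w b) + dot m (w c)).
Hypothesis w_free : det3 (w a) (w b) (w c) != 0.

(** A [true] stands for the sign -1. *)
Definition signs (ta tb tc td t_o : bool) (i : 'I_5) : R :=
  by_pole o a b c (sg t_o) (sg ta) (sg tb) (sg tc) (sg td) i.

Lemma signsE ta tb tc td t_o (t := signs ta tb tc td t_o) :
  [/\ t o = sg t_o, t a = sg ta, t b = sg tb & t c = sg tc /\ t d = sg td].
Proof. exact: by_poleE. Qed.

Definition pole_signed t (i : 'I_5) : pt := (t i * r i) *v P i.

Lemma pole_signed_ge0 m ta tb tc td t_o :
  0 <= sg ta * dot m (w a) -> 0 <= sg tb * dot m (w b) -> 0 <= sg tc * dot m (w c) ->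
  0 <= sg td * dot m (w d) -> 0 <= sg t_o * dot m (w o) ->
  forall i, 0 <= dot m (pole_signed (signs ta tb tc td t_o) i).
Proof.
move=> h1 h2 h3 h4 h5 i; rewrite /pole_signed dotZ -mulrA -dotZ.
have [e1 e2 e3 [e4 e5]] := signsE ta tb tc td t_o.
by case/or4P: (cover i) => [/eqP ->|/eqP ->|/eqP ->|/orP [/eqP ->|/eqP ->]];
  rewrite ?e1 ?e2 ?e3 ?e4 ?e5.
Qed.

Lemma pole_signed_gt0 m ta tb tc td t_o :
  0 < sg ta * dot m (w a) -> 0 < sg tb * dot m (w b) -> 0 < sg tc * dot m (w c) ->
  0 < sg td * dot m (w d) -> 0 < sg t_o * dot m (w o) ->
  forall i, 0 < dot m (pole_signed (signs ta tb tc td t_o) i).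
Proof.
move=> h1 h2 h3 h4 h5 i; rewrite /pole_signed dotZ -mulrA -dotZ.
have [e1 e2 e3 [e4 e5]] := signsE ta tb tc td t_o.
by case/or4P: (cover i) => [/eqP ->|/eqP ->|/eqP ->|/orP [/eqP ->|/eqP ->]];
  rewrite ?e1 ?e2 ?e3 ?e4 ?e5.
Qed.

(** [x1], [x2], [x3] are the values of [y] at [w a], [w b], [w c]; the linear relations give those
    at [w d] and [w o]. The hypotheses put the signed poles in the open hemisphere of [y]. *)
Lemma signed_swirl (ta tb tc td t_o : bool) (x1 x2 x3 : R) :
  0 < sg ta * x1 -> 0 < sg tb * x2 -> 0 < sg tc * x3 ->
  0 < sg td * - (x1 + x2 + x3) -> 0 < sg t_o * (x1 + x2) ->
  exists s y, swirl_in D (pole_cone (pole_signed (signs ta tb tc td t_o)) y) s.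
Proof.
move=> h1 h2 h3 h4 h5.
have [y [y1 y2 y3]] := dual_basis x1 x2 x3 w_free.
set t := signs _ _ _ _ _.
have tn0 i : t i * r i != 0.
  by rewrite mulf_neq0 //; apply: by_pole_neq0; rewrite /sg; case: ifP => _; apply/eqP; lra.
have [hd hdP] := choice (oriented_head SD OD tn0).
have hdP' a' : exists s t0, [/\ 0 < s, 0 < t0 &
    tip D (a', hd a') = s *v tail D (a', hd a') +v t0 *v pole_signed t (f a')].
  by have [s [t0 h]] := hdP a'; exists s, t0.
have yw : forall i, 0 < dot y (pole_signed t i).
  by apply: pole_signed_gt0; rewrite ?w_d ?w_o ?y1 ?y2 ?y3.
have [nx nxP] : exists nx : bool -> 'I_n * bool -> 'I_n * bool, forall cw q, follows D cw q (nx cw q).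
  have [nx0 h0] := choice (follows_exists SD false).
  have [nx1 h1'] := choice (follows_exists SD true).
  by exists (fun cw => if cw then nx1 else nx0); case.
have n0 : (0 < n)%N by case: SD.
by have [s hs] := cone_swirl SD hdP' yw nxP n0; exists s, y.
Qed.

Lemma signed_separation (ta tb tc td t_o ta' tb' tc' td' t_o' : bool) y y' s s' (x1 x2 x3 : R) :
  swirl_in D (pole_cone (pole_signed (signs ta tb tc td t_o)) y) s ->
  swirl_in D (pole_cone (pole_signed (signs ta' tb' tc' td' t_o')) y') s' ->
  [|| x1 != 0, x2 != 0 | x3 != 0] ->
  [/\ 0 <= sg ta * x1, 0 <= sg tb * x2, 0 <= sg tc * x3,
    0 <= sg td * - (x1 + x2 + x3) & 0 <= sg t_o * (x1 + x2)] ->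
  [/\ sg ta' * x1 <= 0, sg tb' * x2 <= 0, sg tc' * x3 <= 0,
    sg td' * - (x1 + x2 + x3) <= 0 & sg t_o' * (x1 + x2) <= 0] ->
  ~ swirl_equiv s s'.
Proof.
move=> hs hs' hx [p1 p2 p3 p4 p5] [n1 n2 n3 n4 n5].
have [h [h1 h2 h3]] := dual_basis x1 x2 x3 w_free.
apply: (separated_swirls (h := h) SD hs hs').
- move=> u [_ hu]; apply: hu; apply: pole_signed_ge0; rewrite ?w_d ?w_o ?h1 ?h2 ?h3 //.
- move=> u [_ hu]; have := hu ((-1) *v h) _; rewrite !dotZl mulN1r oppr_ge0; apply.
  by apply: pole_signed_ge0; rewrite ?w_d ?w_o !dotZl ?h1 ?h2 ?h3; lra.
by case/or3P: hx => hx; [exists (w a)|exists (w b)|exists (w c)]; rewrite ?h1 ?h2 ?h3.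
Qed.

Lemma five_swirls : at_least_swirls D 5.
Proof.
have sgE : (sg false = 1) * (sg true = -1) by [].
(* Here [y] takes the values 2, -1, 1, -2, 1 at [a], [b], [c], [d], [o], with signs +-+-+; likewise
   for the other four. *)
have [s1 [y1 k1]] := @signed_swirl false true false true false 2 (-1) 1
  ltac:(rewrite !sgE; lra) ltac:(rewrite !sgE; lra) ltac:(rewrite !sgE; lra)
  ltac:(rewrite !sgE; lra) ltac:(rewrite !sgE; lra).
have [s2 [y2 k2]] := @signed_swirl false true true false false 2 (-1) (-2)
  ltac:(rewrite !sgE; lra) ltac:(rewrite !sgE; lra) ltac:(rewrite !sgE; lra)
  ltac:(rewrite !sgE; lra) ltac:(rewrite !sgE; lra).
have [s3 [y3 k3]] := @signed_swirl true false false true false (-1) 2 1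
  ltac:(rewrite !sgE; lra) ltac:(rewrite !sgE; lra) ltac:(rewrite !sgE; lra)
  ltac:(rewrite !sgE; lra) ltac:(rewrite !sgE; lra).
have [s4 [y4 k4]] := @signed_swirl true false true false false (-1) 2 (-2)
  ltac:(rewrite !sgE; lra) ltac:(rewrite !sgE; lra) ltac:(rewrite !sgE; lra)
  ltac:(rewrite !sgE; lra) ltac:(rewrite !sgE; lra).
have [s5 [y5 k5]] := @signed_swirl true true false false true (-1) (-1) 1
  ltac:(rewrite !sgE; lra) ltac:(rewrite !sgE; lra) ltac:(rewrite !sgE; lra)
  ltac:(rewrite !sgE; lra) ltac:(rewrite !sgE; lra).
have nz : (1 : R) != 0 by apply/eqP; lra.
(* This [h] vanishes on the plane of [a], [b], [o] and takes the values 1 at [c] and -1 at [d]; the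
   others are likewise given by their values at [a], [b], [c]. *)
have e12 : ~ swirl_equiv s1 s2.
  by apply: (signed_separation (x1 := 0) (x2 := 0) (x3 := 1) k1 k2); rewrite ?nz ?orbT //;
    split; rewrite !sgE; lra.
have e13 : ~ swirl_equiv s1 s3.
  by apply: (signed_separation (x1 := 1) (x2 := -1) (x3 := 0) k1 k3); rewrite ?nz ?orbT //;
    split; rewrite !sgE; lra.
have e14 : ~ swirl_equiv s1 s4.
  by apply: (signed_separation (x1 := 1) (x2 := -1) (x3 := 0) k1 k4); rewrite ?nz ?orbT //;
    split; rewrite !sgE; lra.
have e15 : ~ swirl_equiv s1 s5.
  by apply: (signed_separation (x1 := 1) (x2 := 0) (x3 := 0) k1 k5); rewrite ?nz ?orbT //;
    split; rewrite !sgE; lra.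
have e23 : ~ swirl_equiv s2 s3.
  by apply: (signed_separation (x1 := 1) (x2 := -1) (x3 := 0) k2 k3); rewrite ?nz ?orbT //;
    split; rewrite !sgE; lra.
have e24 : ~ swirl_equiv s2 s4.
  by apply: (signed_separation (x1 := 1) (x2 := -1) (x3 := 0) k2 k4); rewrite ?nz ?orbT //;
    split; rewrite !sgE; lra.
have e25 : ~ swirl_equiv s2 s5.
  by apply: (signed_separation (x1 := 1) (x2 := 0) (x3 := -1) k2 k5); rewrite ?nz ?orbT //;
    split; rewrite !sgE; lra.
have e34 : ~ swirl_equiv s3 s4.
  by apply: (signed_separation (x1 := 0) (x2 := 0) (x3 := 1) k3 k4); rewrite ?nz ?orbT //;
    split; rewrite !sgE; lra.
have e35 : ~ swirl_equiv s3 s5.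
  by apply: (signed_separation (x1 := 0) (x2 := 1) (x3 := 0) k3 k5); rewrite ?nz ?orbT //;
    split; rewrite !sgE; lra.
have e45 : ~ swirl_equiv s4 s5.
  by apply: (signed_separation (x1 := 0) (x2 := 1) (x3 := -1) k4 k5); rewrite ?nz ?orbT //;
    split; rewrite !sgE; lra.
exists (fun i : 'I_5 => nth [::] [:: s1; s2; s3; s4; s5] i); split.
  have [z1 _] := k1; have [z2 _] := k2; have [z3 _] := k3; have [z4 _] := k4; have [z5 _] := k5.
  by case=> [[|[|[|[|[|i]]]]] hi].
have lt i j : (i < j < 5)%N -> ~ swirl_equiv (nth [::] [:: s1; s2; s3; s4; s5] i)
    (nth [::] [:: s1; s2; s3; s4; s5] j).
  case/andP; case: j => [|[|[|[|[|j]]]]] //; by case: i => [|[|[|[|i]]]].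
move=> i j hij; have hne : (i : nat) <> j by move=> h; apply: hij; apply: val_inj.
have [h|h] : (i < j)%N \/ (j < i)%N by lia.
  by apply: lt; rewrite h ltn_ord.
by move=> /swirl_equiv_sym; apply: lt; rewrite h ltn_ord.
Qed.

End FiveCones.

(** * Coplanarity tables for five poles *)

Definition deg_table (col : nat -> nat -> nat -> bool) (i : nat) : nat :=
  size (undup [seq [seq (l != i) && col i j l | l <- iota 0 5] | j <- iota 0 5 & j != i]).

Definition triples : seq (nat * nat * nat) :=
  [:: (0, 1, 2); (0, 1, 3); (0, 1, 4); (0, 2, 3); (0, 2, 4); (0, 3, 4);
      (1, 2, 3); (1, 2, 4); (1, 3, 4); (2, 3, 4)]%N.

Definition sort3 (i j l : nat) : nat * nat * nat :=
  let a := minn i j in let b := maxn i j in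
  if (l <= a)%N then (l, a, b) else if (l <= b)%N then (a, l, b) else (a, b, l).

(** Ten bits, one for each unordered triple, encode a symmetric relation; triples with a repetition
    are always coplanar. *)
Definition table_col (t : seq bool) (i j l : nat) : bool :=
  ~~ uniq [:: i; j; l] || nth true t (index (sort3 i j l) triples).

(** Two distinct poles span a plane, which contains every pole coplanar with them. This is the only
    geometry that the enumeration uses. *)
Definition col_trans (col : nat -> nat -> nat -> bool) : bool :=
  all (fun i => all (fun j => all (fun k => all (fun l =>
    [&& i != j, col i j k & col i j l] ==> col i k l)
    (iota 0 5)) (iota 0 5)) (iota 0 5)) (iota 0 5).

Definition two_lines (col : nat -> nat -> nat -> bool) (s : seq nat) : bool :=
  let x := nth 0%N s in
  [&& col (x 0%N) (x 1%N) (x 2%N), col (x 0%N) (x 3%N) (x 4%N) & ~~ col (x 1%N) (x 2%N) (x 3%N)].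

Fixpoint bit_lists (m : nat) : seq (seq bool) :=
  if m is m'.+1 then [seq true :: s | s <- bit_lists m'] ++ [seq false :: s | s <- bit_lists m']
  else [:: [::]].

Lemma mem_bit_lists t : t \in bit_lists (size t).
Proof.
elim: t => [//|[] t IH] /=; rewrite mem_cat; apply/orP; [left|right]; exact: map_f.
Qed.

(* The ways to choose the double pole and to pair up the other four. *)
Definition orders : seq (seq nat) := [:: [:: 0; 1; 2; 3; 4]; [:: 0; 1; 3; 2; 4]; [:: 0; 1; 4; 2; 3];
  [:: 1; 0; 2; 3; 4]; [:: 1; 0; 3; 2; 4]; [:: 1; 0; 4; 2; 3];
  [:: 2; 0; 1; 3; 4]; [:: 2; 0; 3; 1; 4]; [:: 2; 0; 4; 1; 3];
  [:: 3; 0; 1; 2; 4]; [:: 3; 0; 2; 1; 4]; [:: 3; 0; 4; 1; 2];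
  [:: 4; 0; 1; 2; 3]; [:: 4; 0; 2; 1; 3]; [:: 4; 0; 3; 1; 2]]%N.

(** An exhaustive check of the 1024 tables: the degrees force two planes through the double pole,
    each with two of the others, and the rest in general position. *)
Lemma alignment_table :
  all (fun t => (col_trans (table_col t) &&
      perm_eq [seq deg_table (table_col t) i | i <- iota 0 5] [:: 2; 3; 3; 3; 3]%N) ==>
    has (two_lines (table_col t)) orders) (bit_lists 10).
Proof. by vm_compute. Qed.

(** * The alignment (2,3,3,3,3) *)

Lemma map_enum5 (T : Type) (F : 'I_5 -> T) : [seq F i | i <- enum 'I_5] = [seq F (inord i) | i <- iota 0 5].
Proof. by rewrite -val_enum_ord -map_comp; apply: eq_map => i /=; rewrite inord_val. Qed.

Section Alignment.

Variables (P : 'I_5 -> pt).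
Hypothesis hS : forall i, on_sphere (P i).
Hypothesis hI : injective P.
Hypothesis hA : forall i j, P i <> popp (P j).

Definition col i j l : bool := det3 (P (inord i)) (P (inord j)) (P (inord l)) == 0.

Lemma alignment_deg_table i : (i < 5)%N -> alignment_deg P (inord i) = deg_table col i.
Proof.
move=> hi; rewrite /alignment_deg /deg_table.
set L := (fun j => [set l | _]).
have -> : #|[set L j | j in [set j | j != inord i]]| =
    size (undup [seq L j | j <- enum 'I_5 & j != inord i]).
  rewrite -(card_uniqP (undup_uniq _)); apply: eq_card => X; rewrite mem_undup.
  apply/imsetP/mapP => -[j hj ->]; exists j => //.
    by rewrite mem_filter mem_enum andbT; move: hj; rewrite inE.
  by move: hj; rewrite mem_filter inE => /andP [].
(* Membership bits determine a set, so counting distinct sets becomes counting distinct bit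
   lists. *)
pose code (X : {set 'I_5}) := [seq (l \in X) | l <- enum 'I_5].
have codeI : injective code.
  by move=> X Y /eq_in_map e; apply/setP => l; apply: e; rewrite mem_enum.
rewrite -(size_map code) -undup_map_inj; last exact: codeI.
rewrite -map_comp; congr (size (undup _)).
rewrite -val_enum_ord [in RHS]filter_map -[RHS]map_comp.
have -> : [seq j <- enum 'I_5 | j != inord i] = [seq j <- enum 'I_5 | preim val (fun j => j != i) j].
  by apply: eq_filter => j /=; rewrite -val_eqE /= inordK.
apply: eq_map => j /=; rewrite /code map_enum5 -val_enum_ord -!map_comp; apply: eq_map => l /=.
by rewrite /L !inE /col !inord_val -val_eqE /= inordK.
Qed.

Lemma alignment_degs : [seq alignment_deg P i | i <- enum 'I_5] = [seq deg_table col i | i <- iota 0 5].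
Proof.
rewrite map_enum5; apply/eq_in_map => i.
by rewrite mem_iota => /andP [_ hi]; apply: alignment_deg_table.
Qed.

Lemma colC12 i j l : col j i l = col i j l.
Proof. by rewrite /col det3_swap oppr_eq0. Qed.

Lemma colC23 i j l : col i l j = col i j l.
Proof.
rewrite /col; have -> : det3 (P (inord i)) (P (inord l)) (P (inord j)) =
  - det3 (P (inord i)) (P (inord j)) (P (inord l)) by rewrite /det3; ring.
by rewrite oppr_eq0.
Qed.

Lemma col_eq i j : col i i j.
Proof. by rewrite /col det3_ll. Qed.

Lemma inord_neq i j : (i < 5)%N -> (j < 5)%N -> i <> j -> P (inord i) <> P (inord j).
Proof. by move=> hi hj hij /hI /(congr1 val) /=; rewrite !inordK. Qed.

Lemma pole_indep i j : (i < 5)%N -> (j < 5)%N -> i <> j ->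
  dot (cross (P (inord i)) (P (inord j))) (cross (P (inord i)) (P (inord j))) != 0.
Proof. by move=> hi hj hij; apply: indep_cross => //; apply: inord_neq. Qed.

Lemma col_sort3 i j l : col i j l = let x := sort3 i j l in col x.1.1 x.1.2 x.2.
Proof.
rewrite /sort3 /minn /maxn; case: ltnP => _; case: leqP => _; rewrite /=; try case: leqP => _ //=.
- by rewrite colC23 colC12.
- by rewrite colC23.
- by rewrite colC12 colC23 colC12.
- by rewrite colC12 colC23.
- by rewrite colC12.
Qed.

Lemma col_dup i j l : ~~ uniq [:: i; j; l] -> col i j l.
Proof.
rewrite /= !inE andbT negb_and negbK negbK -orbA => /or3P [/eqP ->|/eqP ->|/eqP ->].
- exact: col_eq.
- by rewrite colC23 col_eq.
- by rewrite colC12 colC23 col_eq.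
Qed.

Lemma col_table : exists t, size t = 10%N /\
  forall i j l, (i < 5)%N -> (j < 5)%N -> (l < 5)%N -> col i j l = table_col t i j l.
Proof.
exists [seq col x.1.1 x.1.2 x.2 | x <- triples]; split => // i j l hi hj hl.
rewrite /table_col; have [hu|hu] := boolP (uniq _); last by rewrite col_dup.
have ht : sort3 i j l \in triples.
  by move: hi hj hl hu; do 5?[case: i => [|i]] => //; do 5?[case: j => [|j]] => //;
    do 5?[case: l => [|l]].
by rewrite (nth_map (0, 0, 0)%N) ?index_mem // nth_index // col_sort3.
Qed.

Lemma table_trans t :
  (forall i j l, (i < 5)%N -> (j < 5)%N -> (l < 5)%N -> col i j l = table_col t i j l) ->
  col_trans (table_col t).
Proof.
move=> ht.
apply/allP => i; rewrite mem_iota add0n => /andP [_ hi].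
apply/allP => j; rewrite mem_iota add0n => /andP [_ hj].
apply/allP => k; rewrite mem_iota add0n => /andP [_ hk].
apply/allP => l; rewrite mem_iota add0n => /andP [_ hl].
rewrite -!ht //; apply/implyP => /and3P [/eqP hij /eqP h1 /eqP h2].
have hd := pole_indep hi hj hij.
have [s1 [t1 e1]] := coplanar_span hd h1.
have [s2 [t2 e2]] := coplanar_span hd h2.
by rewrite /col e1 e2; apply/eqP; rewrite /det3 /padd /pscale /px /py /pz /=; ring.
Qed.

(** With [s = 0] the unit vectors [P k] and [P j] would be equal or antipodal. *)
Lemma span_neq0 i j k (s t : R) : P k <> P j -> P k = s *v P i +v t *v P j -> s != 0.
Proof.
move=> hkj e; apply/eqP => s0; rewrite s0 in e.
have e' m : dot m (P k) = t * dot m (P j) by rewrite e !dotE; ring.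
have ht : t ^+ 2 = 1.
  have := hS k; rewrite /on_sphere e' dotC e' => <-.
  by have := hS j; rewrite /on_sphere => ->; ring.
have [t1|t1] : t = 1 \/ t = -1.
  have h0 : (t - 1) * (t + 1) = 0.
    by rewrite -subr_sqr expr1n ht subrr.
  by move/eqP: h0; rewrite mulf_eq0 => /orP [/eqP h|/eqP h]; [left|right]; lra.
  by apply: hkj; apply: pt_ext => m; rewrite e' t1 mul1r.
by apply: (hA (i := k) (j := j)); apply: pt_ext => m; rewrite e' t1 dotN mulN1r.
Qed.

Lemma span_neq0' i j k (s t : R) : P k <> P i -> P k = s *v P i +v t *v P j -> t != 0.
Proof.
move=> hki e; apply: (@span_neq0 j i k t s hki).
by rewrite e; apply: pt_ext => m; rewrite !dotE addrC.
Qed.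

Lemma alignment_23333 : has_alignment P [:: 2; 3; 3; 3; 3]%N -> exists o a b c d : 'I_5,
  [/\ uniq [:: o; a; b; c; d], det3 (P a) (P b) (P o) = 0, det3 (P c) (P d) (P o) = 0
    & det3 (P a) (P b) (P c) != 0].
Proof.
move=> hal; have [t [st ht]] := col_table.
move: (hal); rewrite /has_alignment alignment_degs => hdeg.
have hmem : t \in bit_lists 10 by rewrite -st mem_bit_lists.
have := allP alignment_table t hmem; rewrite table_trans // andTb.
have -> : [seq deg_table (table_col t) i | i <- iota 0 5] = [seq deg_table col i | i <- iota 0 5].
  apply/eq_in_map => i; rewrite mem_iota => /andP [_ hi]; rewrite /deg_table.
  congr (size (undup _)); apply/eq_in_map => j; rewrite mem_filter mem_iota => /and3P [_ _ hj].
  by apply/eq_in_map => l; rewrite mem_iota => /andP [_ hl]; rewrite ht.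
rewrite hdeg => /hasP [s hs].
have [us ss ls] : [/\ uniq s, size s = 5%N & all (fun x => x < 5)%N s].
  have : all (fun s => [&& uniq s, size s == 5%N & all (fun x => x < 5)%N s]) orders by [].
  by move/allP => /(_ s hs) /and3P [h1 /eqP h2 h3].
case: s ss us ls {hs} => [|o [|a [|b [|c [|d [|//]]]]]] // _ us ls.
have [ho ha hb [hc hd]] : [/\ (o < 5)%N, (a < 5)%N, (b < 5)%N & (c < 5)%N /\ (d < 5)%N].
  by move: ls => /= /and5P [ho ha hb hc /andP [hd _]]; split.
rewrite /two_lines -!ht // => /and3P [/eqP h1 /eqP h2 h3].
exists (inord o), (inord a), (inord b), (inord c), (inord d); split.
- by rewrite -(map_inj_uniq val_inj) [map _ _]/= !inordK.
- by rewrite det3_cyc det3_cyc.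
- by rewrite det3_cyc det3_cyc.
- exact: h3.
Qed.

End Alignment.

Theorem lower_bound n (D : 'I_n -> sarc) (P : 'I_5 -> pt) (f : 'I_n -> 'I_5) :
  spherical_diagram D -> oriented D P f -> has_alignment P [:: 2; 3; 3; 3; 3]%N ->
  at_least_swirls D 5.
Proof.
move=> SD OD hal; have [hS [hI [hA _]]] := OD.
have [o [a [b [c [d [u5 h1 h2 h3]]]]]] := alignment_23333 hS hI hA hal.
move: (u5); rewrite /= !inE !negb_or.
move=> /and5P [/and4P [oa ob oc od] /and3P [ab ac ad] /andP [bc bd] cd _].
have neq i j : i != j -> P i <> P j by move=> h /hI e; rewrite e eqxx in h.
have ind i j : i != j -> dot (cross (P i) (P j)) (cross (P i) (P j)) != 0.
  by move=> h; apply: indep_cross => //; apply: neq.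
have [al [be e1]] := coplanar_span (ind _ _ ab) h1.
have [ga [de e2]] := coplanar_span (ind _ _ cd) h2.
have al0 := span_neq0 hS hA (neq _ _ ob) e1; have be0 := span_neq0' hS hA (neq _ _ oa) e1.
have ga0 := span_neq0 hS hA (neq _ _ od) e2; have de0 := span_neq0' hS hA (neq _ _ oc) e2.
(* From [P o = al *v P a +v be *v P b = ga *v P c +v de *v P d]: the minus signs make the four
   rescaled poles sum to zero. *)
pose r := by_pole o a b c 1 al be (- ga) (- de).
have [ro ra rb [rc rd]] : [/\ r o = 1, r a = al, r b = be & r c = - ga /\ r d = - de].
  exact: by_poleE.
apply: (@five_swirls n D P f SD OD o a b c d r) => //.
- by apply: by_pole_neq0; rewrite ?oppr_eq0 ?oner_eq0.
- move=> i; have : i \in [:: o; a; b; c; d]; last by rewrite !inE.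
  have [//|hi] := boolP (i \in _).
  have : uniq (i :: [:: o; a; b; c; d]) by rewrite [uniq _]/= hi.
  by move/card_uniqP => /= e; have := max_card (mem (i :: [:: o; a; b; c; d])); rewrite e card_ord.
- by move=> m; rewrite ro ra rb !dotZ e1 !dotE; ring.
- move=> m; rewrite ra rb rc rd !dotZ.
  by have := congr1 (dot m) e1; rewrite e2 !dotE; lra.
- rewrite ra rb rc; have -> : det3 (al *v P a) (be *v P b) (- ga *v P c) =
    (- (al * be * ga)) * det3 (P a) (P b) (P c).
    by rewrite /det3 /pscale /px /py /pz /=; ring.
  by rewrite mulf_neq0 // oppr_eq0 !mulf_neq0.
Qed.

(** * Diagrams with integer coordinates *)

Delimit Scope Z_scope with ZZ.

Notation IZR := Rdefinitions.IZR.

Definition zpt := (Z * Z * Z)%type.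
Definition zdot (u v : zpt) : Z := (u.1.1 * v.1.1 + u.1.2 * v.1.2 + u.2 * v.2)%ZZ.
Definition zcross (u v : zpt) : zpt := (u.1.2 * v.2 - u.2 * v.1.2, u.2 * v.1.1 - u.1.1 * v.2,
  u.1.1 * v.1.2 - u.1.2 * v.1.1)%ZZ.
Definition zdet (u v w : zpt) : Z := zdot (zcross u v) w.

Definition toR (u : zpt) : pt := (IZR u.1.1, IZR u.1.2, IZR u.2).

Lemma IZR_add a b : IZR (Z.add a b) = IZR a + IZR b.
Proof. exact: RIneq.plus_IZR. Qed.

Lemma IZR_mul a b : IZR (Z.mul a b) = IZR a * IZR b.
Proof. exact: RIneq.mult_IZR. Qed.

Lemma IZR_sub a b : IZR (Z.sub a b) = IZR a - IZR b.
Proof. exact: RIneq.minus_IZR. Qed.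

Lemma IZR_opp a : IZR (Z.opp a) = - IZR a.
Proof. exact: RIneq.opp_IZR. Qed.

Lemma IZR_gt0 a : (0 <? a)%ZZ -> 0 < IZR a.
Proof. by move=> /Z.ltb_lt h; apply/RltP; apply: RIneq.IZR_lt. Qed.

Lemma IZR_lt0 a : (a <? 0)%ZZ -> IZR a < 0.
Proof. by move=> /Z.ltb_lt h; apply/RltP; apply: RIneq.IZR_lt. Qed.

Lemma IZR_ge0 a : (0 <=? a)%ZZ -> 0 <= IZR a.
Proof. by move=> /Z.leb_le h; apply/RleP; apply: RIneq.IZR_le. Qed.

Lemma IZR_le0 a : (a <=? 0)%ZZ -> IZR a <= 0.
Proof. by move=> /Z.leb_le h; apply/RleP; apply: RIneq.IZR_le. Qed.

Lemma dot_toR u v : dot (toR u) (toR v) = IZR (zdot u v).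
Proof. by rewrite /zdot !(IZR_add, IZR_mul). Qed.

Lemma cross_toR u v : cross (toR u) (toR v) = toR (zcross u v).
Proof. by rewrite /toR /zcross /= !(IZR_sub, IZR_mul). Qed.

Lemma det3_toR u v w : det3 (toR u) (toR v) (toR w) = IZR (zdet u v w).
Proof. by rewrite -dot_cross cross_toR dot_toR. Qed.

Definition normalize (u : pt) : pt := (Num.sqrt (dot u u))^-1 *v u.

Lemma normalize_sphere u : 0 < dot u u -> on_sphere (normalize u).
Proof.
move=> h; rewrite /on_sphere !(dotE, dotZl) mulrA -expr2 exprVn sqr_sqrtr ?ltW // mulVf //.
by rewrite gt_eqF.
Qed.

Lemma normalizeE u : 0 < dot u u -> exists2 c : R, 0 < c & normalize u = c *v u.
Proof. by move=> h; exists (Num.sqrt (dot u u))^-1 => //; rewrite invr_gt0 sqrtr_gt0. Qed.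

Lemma det3_scale a b c (x y z : R) :
  det3 (x *v a) (y *v b) (z *v c) = x * y * z * det3 a b c.
Proof. by rewrite /det3 /pscale /px /py /pz /=; ring. Qed.

Definition nonzero (u : zpt) := (0 <? zdot u u)%ZZ.

(** The last two conditions are the positivity of the coefficients of [u] over [a] and [b], as in
    [cross_expand]. *)
Definition zin (a b u : zpt) := let n := zcross a b in
  [&& nonzero n, (zdet a b u =? 0)%ZZ, (0 <? zdet u b n)%ZZ & (0 <? zdet a u n)%ZZ].

Lemma zinP a b u : zin a b u -> exists s t : R, [/\ 0 < s, 0 < t & toR u = s *v toR a +v t *v toR b].
Proof.
move=> /and4P [/IZR_gt0 h0 /Z.eqb_eq h1 /IZR_gt0 h2 /IZR_gt0 h3].
have h0' : 0 < dot (cross (toR a) (toR b)) (cross (toR a) (toR b)) by rewrite cross_toR dot_toR.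
rewrite -!det3_toR -!cross_toR in h2 h3.
set k := dot _ _ in h0'.
exists (det3 (toR u) (toR b) (cross (toR a) (toR b)) / k), (det3 (toR a) (toR u) (cross (toR a) (toR b)) / k).
split; try exact: divr_gt0.
apply: pt_ext => m; rewrite !dotE; apply: (mulfI (lt0r_neq0 h0')).
by rewrite /k cross_expand det3_toR h1 /= -/k mul0r addr0; field; rewrite gt_eqF.
Qed.

Lemma nonzeroP u : nonzero u -> 0 < dot (toR u) (toR u).
Proof. by rewrite dot_toR; apply: IZR_gt0. Qed.

Lemma nonzero_cross a b : nonzero (zcross a b) -> nonzero a /\ nonzero b.
Proof.
move=> /nonzeroP; rewrite -cross_toR => h.
have h2 : 0 < dot (toR a) (toR a) * dot (toR b) (toR b).
  apply: lt_le_trans h _; rewrite lagrange; have := sqr_ge0 (dot (toR a) (toR b)); lra.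
have ha := dot_sq_ge0 (toR a); have hb := dot_sq_ge0 (toR b).
have pos z : 0 < dot (toR z) (toR z) -> nonzero z.
  rewrite dot_toR /nonzero => /RltP hz; apply/Z.ltb_lt; exact: RIneq.lt_IZR.
by split; apply: pos; rewrite lt_neqAle ?ha ?hb andbT; apply/eqP => e; move: h2;
  rewrite -e ?mul0r ?mulr0 ltxx.
Qed.

Definition in_half (h : zpt) (a b c d : zpt) :=
  [&& (0 <=? zdot h a)%ZZ, (0 <=? zdot h b)%ZZ, (zdot h c <=? 0)%ZZ, (zdot h d <=? 0)%ZZ &
    [|| (0 <? zdot h a)%ZZ, (0 <? zdot h b)%ZZ, (zdot h c <? 0)%ZZ | (zdot h d <? 0)%ZZ]].

(** Candidates for the separating plane are those through two of the four ends, in both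
    orientations; the strict clause of [in_half] rejects the zero normal. *)
Definition zdisjoint (a b c d : zpt) :=
  has (fun u => has (fun v => in_half (zcross u v) a b c d) [:: a; b; c; d]) [:: a; b; c; d].

Lemma has_exists (T : Type) (p : pred T) s : has p s -> exists x, p x.
Proof. by elim: s => [//|x s IH] /= /orP [hx|/IH //]; exists x. Qed.

Lemma zdisjointP a b c d : zdisjoint a b c d -> forall s t s' t' : R, 0 < s -> 0 < t -> 0 < s' -> 0 < t' ->
  s *v toR a +v t *v toR b <> s' *v toR c +v t' *v toR d.
Proof.
rewrite /zdisjoint => /has_exists [u /has_exists [v]]; move: (zcross u v) => h.
move=> /and5P [/IZR_ge0 h1 /IZR_ge0 h2 /IZR_le0 h3 /IZR_le0 h4 h5] s t s' t' hs ht hs' ht' e.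
have := congr1 (dot (toR h)) e; rewrite !dotE !dot_toR.
have g1 : 0 <= s * IZR (zdot h a) by apply: mulr_ge0 => //; exact: ltW.
have g2 : 0 <= t * IZR (zdot h b) by apply: mulr_ge0 => //; exact: ltW.
have g3 : s' * IZR (zdot h c) <= 0 by rewrite pmulr_rle0.
have g4 : t' * IZR (zdot h d) <= 0 by rewrite pmulr_rle0.
case/or4P: h5 => h5.
- have := mulr_gt0 hs (IZR_gt0 h5); lra.
- have := mulr_gt0 ht (IZR_gt0 h5); lra.
- have : s' * IZR (zdot h c) < 0 by rewrite pmulr_rlt0 //; apply: IZR_lt0.
  lra.
- have : t' * IZR (zdot h d) < 0 by rewrite pmulr_rlt0 //; apply: IZR_lt0.
  lra.
Qed.

Section Certificate.

(* [blocks] lists the arcs that block the source and the target of each arc. *)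
Variables (n' : nat) (arcs : seq (zpt * zpt)) (blocks : seq (nat * nat)).
Notation n := n'.+1.
(* A swirl is listed as its sense of rotation, one of its states, and its length. *)
Variables (swirls : seq (bool * (nat * bool) * nat)).

Definition zend (i : nat) (e : bool) : zpt :=
  let a := nth ((0, 0, 0), (0, 0, 0))%ZZ arcs i in if e then a.2 else a.1.

Definition blocker (i : nat) (e : bool) : nat :=
  let b := nth (0, 0)%N blocks i in if e then b.2 else b.1.

Definition zarc (i : 'I_n) : sarc :=
  SArc (normalize (toR (zend i false))) (normalize (toR (zend i true))).

Definition check_arcs := all (fun i => nonzero (zcross (zend i false) (zend i true))) (iota 0 n).

(** The last condition puts the ends of the blocker strictly on opposite sides of the plane of arc
    [i], so each sense of turning selects exactly one end. *)
Definition check_hits := all (fun i => all (fun e => let j := blocker i e in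
  [&& (j < n)%N, zin (zend j false) (zend j true) (zend i e) &
  (zdet (zend i (~~ e)) (zend i e) (zend j false) * zdet (zend i (~~ e)) (zend i e) (zend j true) <? 0)%ZZ])
  [:: false; true]) (iota 0 n).

Definition check_disjoint := all (fun i => all (fun j => (i == j) ||
  zdisjoint (zend i false) (zend i true) (zend j false) (zend j true)) (iota 0 n)) (iota 0 n).

Hypotheses (Harcs : check_arcs) (Hhits : check_hits) (Hdisj : check_disjoint).

Lemma zend_pos i e : (i < n)%N -> 0 < dot (toR (zend i e)) (toR (zend i e)).
Proof.
move=> hi; have := allP Harcs i; rewrite mem_iota => /(_ hi) /nonzero_cross [h1 h2].
by apply: nonzeroP; case: e.
Qed.

Lemma endpoint_zarc (i : 'I_n) e : endpoint (zarc i) e = normalize (toR (zend i e)).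
Proof. by case: e. Qed.

Lemma zarc_det (i j : 'I_n) (e e' : bool) : exists2 c : R, 0 < c &
  det3 (other_endpoint (zarc i) e) (endpoint (zarc i) e) (endpoint (zarc j) e') =
  c * IZR (zdet (zend i (~~ e)) (zend i e) (zend j e')).
Proof.
rewrite /other_endpoint !endpoint_zarc.
have [x hx ->] := normalizeE (zend_pos (~~ e) (ltn_ord i)).
have [y hy ->] := normalizeE (zend_pos e (ltn_ord i)).
have [z hz ->] := normalizeE (zend_pos e' (ltn_ord j)).
by exists (x * y * z); [rewrite !mulr_gt0|rewrite det3_scale det3_toR].
Qed.

Lemma hit_data i e : (i < n)%N -> [/\ (blocker i e < n)%N,
  zin (zend (blocker i e) false) (zend (blocker i e) true) (zend i e) &
  (zdet (zend i (~~ e)) (zend i e) (zend (blocker i e) false)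
   * zdet (zend i (~~ e)) (zend i e) (zend (blocker i e) true) <? 0)%ZZ].
Proof.
move=> hi; have := allP Hhits i; rewrite mem_iota => /(_ hi) /allP /(_ e) h.
by apply/and3P; apply: h; case: e.
Qed.

Lemma zarc_cone (i : 'I_n) (s t : R) : 0 < s -> 0 < t -> exists s' t' : R, [/\ 0 < s', 0 < t' &
  s *v src (zarc i) +v t *v tgt (zarc i) = s' *v toR (zend i false) +v t' *v toR (zend i true)].
Proof.
move=> hs ht; rewrite /zarc /=.
have [x hx ->] := normalizeE (zend_pos false (ltn_ord i)).
have [y hy ->] := normalizeE (zend_pos true (ltn_ord i)).
exists (s * x), (t * y); split; try exact: mulr_gt0.
by apply: pt_ext => m; rewrite !dotE; ring.
Qed.

Lemma zarc_hit (i : 'I_n) e : arc_interior (zarc (inord (blocker i e))) (endpoint (zarc i) e).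
Proof.
have [hj /zinP [s [t [hs ht eu]]] _] := hit_data e (ltn_ord i).
rewrite endpoint_zarc; split; first by apply: normalize_sphere; apply: zend_pos.
rewrite /zarc /= inordK //.
have [x hx ->] := normalizeE (zend_pos false hj).
have [y hy ->] := normalizeE (zend_pos true hj).
have [z hz ->] := normalizeE (zend_pos e (ltn_ord i)).
exists (z * s / x), (z * t / y); do 2!(split; first by rewrite divr_gt0 // mulr_gt0).
by apply: pt_ext => m; rewrite eu !dotE; field; rewrite !gt_eqF.
Qed.

Lemma zarc_geodesic (i : 'I_n) : geodesic_arc (zarc i).
Proof.
have h1 := zend_pos false (ltn_ord i); have h2 := zend_pos true (ltn_ord i).
have hc : 0 < dot (cross (toR (zend i false)) (toR (zend i true))) (cross (toR (zend i false)) (toR (zend i true))).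
  by rewrite cross_toR; apply: nonzeroP; have := allP Harcs i; rewrite mem_iota => /(_ (ltn_ord i)).
have [x hx ex] := normalizeE h1; have [y hy ey] := normalizeE h2.
have ind : dot (cross (toR (zend i false)) (toR (zend i true))) (cross (toR (zend i false)) (toR (zend i true))) != 0.
  by rewrite gt_eqF.
split; first exact: normalize_sphere. split; first exact: normalize_sphere.
rewrite /zarc /= ex ey; split => e.
  have [x0 _] : x = 0 /\ - y = 0.
    by apply: (indep_eq0 ind) => m; have := congr1 (dot m) e; rewrite !dotE; lra.
  by rewrite x0 ltxx in hx.
have [x0 _] : x = 0 /\ y = 0.
  by apply: (indep_eq0 ind) => m; have := congr1 (dot m) e; rewrite !dotE; lra.
by rewrite x0 ltxx in hx.
Qed.

Lemma zarc_diagram : spherical_diagram zarc.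
Proof.
split=> //; split; first exact: zarc_geodesic.
split; last by move=> i e; exists (inord (blocker i e)); apply: zarc_hit.
move=> i j hij u [_ [s [t [hs [ht e1]]]]] [_ [s' [t' [hs' [ht' e2]]]]].
have [a [b [ha hb e3]]] := zarc_cone i hs ht; have [c [d [hc hd e4]]] := zarc_cone j hs' ht'.
have := allP Hdisj i; rewrite mem_iota => /(_ (ltn_ord i)) /allP /(_ j).
rewrite mem_iota => /(_ (ltn_ord j)) /orP [/eqP h|h]; first by apply: hij; apply: val_inj.
by apply: (zdisjointP h ha hb hc hd); rewrite -e3 -e4 -e1 -e2.
Qed.

(** Interiors are disjoint, so an end has a single blocker and [blocks] records all hits of the
    diagram. *)
Lemma zarc_blocker (i j : 'I_n) e : arc_interior (zarc j) (endpoint (zarc i) e) -> j = inord (blocker i e).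
Proof.
move=> h; apply: (inarc_inj zarc_diagram (arc_interior_inarc h) (arc_interior_inarc (zarc_hit i e))).
Qed.

Definition check_one_sided := all (fun i => all (fun j => all (fun e => all (fun e' =>
  (blocker i e == blocker j e') ==> let k := blocker i e in
  (0 <? zdet (zend k false) (zend k true) (zend i (~~ e)) * zdet (zend k false) (zend k true) (zend j (~~ e')))%ZZ)
  [:: false; true]) [:: false; true]) (iota 0 n)) (iota 0 n).

Lemma zarc_occlusion : check_one_sided -> spherical_occlusion_diagram zarc.
Proof.
move=> hc; split; first exact: zarc_diagram.
move=> a b c eb ec /zarc_blocker h1 /zarc_blocker h2.
have [hb1 _ _] := hit_data eb (ltn_ord b); have [hc1 _ _] := hit_data ec (ltn_ord c).
have eq : blocker b eb = blocker c ec.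
  by have := congr1 val (etrans (esym h1) h2); rewrite /= !inordK.
have := allP hc b; rewrite mem_iota => /(_ (ltn_ord b)) /allP /(_ c).
rewrite mem_iota => /(_ (ltn_ord c)) /allP /(_ eb) H.
have /allP /(_ ec) H' := H ltac:(by case: (eb)).
have /implyP H'' := H' ltac:(by case: (ec)).
have /IZR_gt0 := H'' ltac:(by rewrite eq); rewrite IZR_mul => h.
have ha : (a : nat) = blocker b eb by rewrite h1 inordK.
have [x hx e1] := zarc_det a b true (~~ eb); have [y hy e2] := zarc_det a c true (~~ ec).
rewrite /other_endpoint /= in e1 e2 *; rewrite e1 e2 ha.
have hxy : 0 < x * y by exact: mulr_gt0.
have -> (p q : R) : x * p * (y * q) = x * y * (p * q) by ring.
exact: mulr_gt0.
Qed.

Definition zsg (cw : bool) : Z := if cw then (-1)%ZZ else 1%ZZ.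

(** The integer form of [follows], which is a function here: the blocker is unique, and so is its
    end on the side of the turn. *)
Definition zstep (cw : bool) (q : nat * bool) : nat * bool :=
  let j := blocker q.1 q.2 in
  (j, (0 <? zsg cw * zdet (zend q.1 (~~ q.2)) (zend q.1 q.2) (zend j true))%ZZ).

Definition ostate (q : nat * bool) : 'I_n * bool := (inord q.1, q.2).

Lemma zstep_lt cw q : (q.1 < n)%N -> ((zstep cw q).1 < n)%N.
Proof. by move=> hq; have [] := hit_data q.2 hq. Qed.

Lemma zstep_turn cw q (i := ostate q) (j := (zstep cw q).1) e : (q.1 < n)%N ->
  (0 < sg cw * det3 (other_endpoint (zarc i.1) i.2) (endpoint (zarc i.1) i.2) (endpoint (zarc (inord j)) e))
  = (e == (zstep cw q).2).
Proof.
move=> hq; have [hj _ hz] := hit_data q.2 hq.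
have [c hc ->] := zarc_det i.1 (inord j) i.2 e.
rewrite /i /j /= !inordK //; move: hz; set u := zdet _ _ (zend _ false).
rewrite /=; set v := zdet _ _ (zend _ true) => /Z.ltb_lt hz.
have -> : (0 < sg cw * (c * IZR (zdet (zend q.1 (~~ q.2)) (zend q.1 q.2) (zend (blocker q.1 q.2) e))))
   = (0 <? zsg cw * zdet (zend q.1 (~~ q.2)) (zend q.1 q.2) (zend (blocker q.1 q.2) e))%ZZ.
  set x := zdet _ _ _; rewrite mulrCA pmulr_rgt0 //.
  have -> : sg cw = IZR (zsg cw) by case: (cw); rewrite /sg /zsg /= ?IZR_opp.
  have -> : IZR (zsg cw) * IZR x = IZR (Z.mul (zsg cw) x) by rewrite IZR_mul.
  apply/idP/idP; last exact: IZR_gt0.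
  by move=> /RltP h; apply/Z.ltb_lt; apply: RIneq.lt_IZR.
have nz : (0 < zsg cw * u)%ZZ <-> ~ (0 < zsg cw * v)%ZZ by rewrite /zsg; case: (cw); nia.
case: e; rewrite -/u -/v.
  by case: (Z.ltb_spec _ _).
by case: (Z.ltb_spec _ _) => h1; case: (Z.ltb_spec _ _) => h2 //; exfalso; lia.
Qed.

Lemma zstep_follows cw q : (q.1 < n)%N -> follows zarc cw (ostate q) (ostate (zstep cw q)).
Proof.
move=> hq.
have h : arc_interior (zarc (ostate (zstep cw q)).1) (tip zarc (ostate q)).
  have := zarc_hit (inord q.1) q.2; by rewrite inordK.
split => //; first exact: arc_interior_inarc h.
rewrite nrmE /tip /tail [(ostate (zstep cw q)).1]/=.
by rewrite (zstep_turn _ _ hq).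
Qed.

Definition orbit_arcs cw q m := mkseq (fun k => (iter k (zstep cw) q).1) m.

Definition swirl_list := [seq orbit_arcs x.1.1 x.1.2 x.2 | x <- swirls].

Definition check_swirls := all (fun x => let: (cw, q, m) := x in
  [&& (0 < m)%N, (q.1 < n)%N, iter m (zstep cw) q == q & uniq (orbit_arcs cw q m)]) swirls.

(** Lists that are not permutations of each other are not rotations of each other, so one test
    covers all rotations. *)
Definition check_inequivalent := pairwise (fun s t => ~~ perm_eq s t) swirl_list.

(** Periods up to [n] are enough, because the arcs of a swirl are distinct. *)
Definition check_complete := all (fun cw => all (fun i => all (fun e => all (fun m =>
  (iter m (zstep cw) (i, e) == (i, e)) && uniq (orbit_arcs cw (i, e) m) ==>
  has (fun s => has (fun k => orbit_arcs cw (i, e) m == rot k s) (iota 0 n)) swirl_list)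
  (iota 1 n)) [:: false; true]) (iota 0 n)) [:: false; true].

Lemma iter_zstep_lt cw q k : (q.1 < n)%N -> ((iter k (zstep cw) q).1 < n)%N.
Proof. by move=> hq; elim: k => [//|k IH] /=; apply: zstep_lt. Qed.

Lemma listed_swirl s : check_swirls -> s \in swirl_list -> swirl zarc [seq inord x | x <- s].
Proof.
move=> hs /mapP [[[cw q] m] hx ->] /=.
have := allP hs _ hx => /and4P [m0 hq /eqP hm hu].
pose g k := ostate (iter k (zstep cw) q).
case: m m0 hm hu {hx} => // m _ hm hu.
have : swirl_in zarc (fun=> True) (mkseq (fun i => (g i).1) m.+1).
  apply: (@cycle_swirl _ _ zarc_diagram cw g m) => //.
  - by move=> i; apply: zstep_follows; apply: iter_zstep_lt.
  - by rewrite /g hm.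
  - move=> i j hi hj /(congr1 val) /=; rewrite !inordK ?iter_zstep_lt // => e.
    have hi' : (i < size (orbit_arcs cw q m.+1))%N by rewrite size_mkseq.
    have hj' : (j < size (orbit_arcs cw q m.+1))%N by rewrite size_mkseq.
    by apply/eqP; rewrite -(nth_uniq 0%N hi' hj' hu) !nth_mkseq // e.
by case; rewrite /orbit_arcs /mkseq -map_comp.
Qed.

(** Sense and current state determine the next state, so a swirl is a periodic orbit of [zstep];
    this makes listing all swirls a finite search. *)
Lemma swirl_orbit s : swirl zarc s -> exists cw q, [/\ (q.1 < n)%N,
  (0 < size s <= n)%N, uniq (orbit_arcs cw q (size s)), iter (size s) (zstep cw) q = q &
  s = [seq inord x | x <- orbit_arcs cw q (size s)]].
Proof.
move=> [us [s0 [e [cw hsw]]]].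
case: s us s0 hsw => // a0 s' us _ hsw; set s := a0 :: s' in us hsw *.
have ha0 : a0 \in s by rewrite mem_head.
pose q : nat * bool := (val a0, e a0).
have step a : a \in s -> zstep cw (val a, e a) = (val (next s a), e (next s a)).
  move=> ha; have [hh ht] := hsw a ha.
  have en := zarc_blocker hh.
  have hb : val (next s a) = blocker a (e a) by rewrite en /= inordK //; have [] := hit_data (e a) (ltn_ord a).
  have h := @zstep_turn cw (val a, e a) (e (next s a)) (ltn_ord a).
  apply: injective_projections; first by rewrite hb.
  apply/esym/eqP; rewrite -h /= inord_val -en.
  by move: ht; rewrite /sg; case: (cw); rewrite ?mul1r // mulN1r oppr_gt0.
have it k : iter k (zstep cw) q = (val (iter k (next s) a0), e (iter k (next s) a0)) /\ iter k (next s) a0 \in s.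
  elim: k => [//|k [IH1 IH2]]; rewrite !iterS IH1 step //; split => //.
  by rewrite mem_next.
have [m em hl] : exists2 m, s' = traject (next s) (next s a0) m & next s (last a0 s') = a0.
  have := cycle_next us; rewrite {2}/s /cycle rcons_path => /andP [/fpathP [m em] /eqP hl].
  by exists m.
have sz : size s = m.+1 by have := congr1 size em; rewrite size_traject /s /= => ->.
have tr : s = traject (next s) a0 (size s) by rewrite sz /= -em.
have es : map val s = orbit_arcs cw q (size s).
  rewrite {1}tr; apply: (@eq_from_nth _ 0%N); first by rewrite size_map size_traject size_mkseq.
  move=> k; rewrite size_map size_traject => hk.
  by rewrite (nth_map a0) ?size_traject // nth_traject // nth_mkseq // (it k).1.
exists cw, q; split.
- exact: ltn_ord.
- by rewrite /=; have := max_card (mem s); rewrite (card_uniqP us) card_ord.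
- by rewrite -es map_inj_uniq //; apply: val_inj.
- rewrite (it (size s)).1; have -> // : iter (size s) (next s) a0 = a0.
  by rewrite sz iterS -[RHS]hl; congr (next s _); rewrite em last_traject.
- by rewrite -es -map_comp map_id_in // => x _ /=; rewrite inord_val.
Qed.

Lemma certified_swirls m : size swirls = m -> check_swirls -> check_inequivalent -> check_complete ->
  exactly_swirls zarc m.
Proof.
move=> hm h1 h2 h3.
have sl : size swirl_list = m by rewrite size_map.
exists (fun i : 'I_m => [seq inord x | x <- nth [::] swirl_list i]); split.
  by move=> i; apply: listed_swirl => //; apply: mem_nth; rewrite sl.
have lt5 s : s \in swirl_list -> map val ([seq inord x | x <- s] : seq 'I_n) = s.
  move=> /mapP [[[cw q] k] hx ->]; rewrite -map_comp map_id_in // => x /mapP [l _ ->] /=.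
  rewrite inordK // iter_zstep_lt //.
  by have := allP h1 _ hx => /and4P [].
split.
  have ne i j : (i < j < m)%N -> ~ perm_eq (nth [::] swirl_list i) (nth [::] swirl_list j).
    move=> /andP [hij hj]; apply/negP.
    by move: h2 => /(pairwiseP [::]) /(_ i j); apply => //; rewrite inE sl //; exact: ltn_trans hj.
  have peq (i j : 'I_m) : swirl_equiv ([seq inord x | x <- nth [::] swirl_list i] : seq 'I_n)
      [seq inord x | x <- nth [::] swirl_list j] ->
      perm_eq (nth [::] swirl_list i) (nth [::] swirl_list j).
    move=> [k e]; rewrite -(lt5 (nth [::] swirl_list i)) ?mem_nth ?sl //.
    rewrite -(lt5 (nth [::] swirl_list j)) ?mem_nth ?sl //; apply: perm_map.
    by rewrite e perm_sym perm_rot.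
  move=> i j hij /peq hp; have hne : (i : nat) <> j by move=> h; apply: hij; apply: val_inj.
  have [h|h] : (i < j)%N \/ (j < i)%N by lia.
    by apply: (ne i j) hp; rewrite h ltn_ord.
  by apply: (ne j i); rewrite ?h ?ltn_ord // perm_sym.
move=> s hs; have [cw [[i e] [hi hsz hu hit es]]] := swirl_orbit hs.
have := allP h3 cw ltac:(by case: (cw)) => /allP /(_ i); rewrite mem_iota => /(_ hi) /allP /(_ e) H.
have /allP /(_ (size s)) H' := H ltac:(by case: (e)).
have := H' ltac:(by rewrite mem_iota add1n ltnS); rewrite hit eqxx hu andTb implyTb.
move=> /hasP [t ht] /hasP [k _ /eqP ek].
have hi' : (index t swirl_list < m)%N by rewrite -sl index_mem.
exists (Ordinal hi'); exists k; rewrite /= nth_index // es ek.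
by rewrite map_rot.
Qed.

End Certificate.

(** * Poles with integer coordinates *)

Definition dir_of (n : nat) (dirs : seq nat) (i : 'I_n) : 'I_5 := inord (nth 0%N dirs i).

Lemma det3_span1 a b (s t : R) :
  det3 (s *v a +v t *v b) b (cross a b) = s * dot (cross a b) (cross a b).
Proof.
by case: a b => [[a1 a2] a3] [[b1 b2] b3]; rewrite /det3 /dot /padd /pscale /cross /px /py /pz /=; ring.
Qed.

Lemma det3_span2 a b (s t : R) :
  det3 a (s *v a +v t *v b) (cross a b) = t * dot (cross a b) (cross a b).
Proof.
by case: a b => [[a1 a2] a3] [[b1 b2] b3]; rewrite /det3 /dot /padd /pscale /cross /px /py /pz /=; ring.
Qed.

Section Poles.

Variables (n' : nat) (arcs : seq (zpt * zpt)) (dirs : seq nat) (poles : seq zpt).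
Notation n := n'.+1.

Definition zpole (i : nat) : zpt := nth (0, 0, 0)%ZZ poles i.

Definition pole (i : 'I_5) : pt := normalize (toR (zpole i)).

Definition check_poles := all (fun i => nonzero (zpole i) && all (fun j => (i == j) ||
  nonzero (zcross (zpole i) (zpole j))) (iota 0 5)) (iota 0 5).

(** The last product is negative when the coefficients of the pole over the ends of the arc have
    opposite signs, which keeps both the pole and its antipode off the closed arc. *)
Definition check_oriented := all (fun i => let p := zpole (nth 0%N dirs i) in
  let a := zend arcs i false in let b := zend arcs i true in
  [&& (nth 0%N dirs i < 5)%N, (zdet a b p =? 0)%ZZ &
    (zdet p b (zcross a b) * zdet a p (zcross a b) <? 0)%ZZ]) (iota 0 n).

Definition zcol i j l := (zdet (zpole i) (zpole j) (zpole l) =? 0)%ZZ.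

Hypotheses (Harcs : check_arcs n' arcs) (Hpoles : check_poles).

Lemma zpole_pos i : (i < 5)%N -> 0 < dot (toR (zpole i)) (toR (zpole i)).
Proof.
by move=> hi; have := allP Hpoles i; rewrite mem_iota => /(_ hi) /andP [/nonzeroP].
Qed.

Lemma pole_alignment ds : perm_eq [seq deg_table zcol i | i <- iota 0 5] ds -> has_alignment pole ds.
Proof.
rewrite /has_alignment alignment_degs; congr (is_true (perm_eq _ ds)).
apply/eq_in_map => i; rewrite mem_iota => /andP [_ hi]; rewrite /deg_table.
congr (size (undup _)); apply/eq_in_map => j; rewrite mem_filter mem_iota => /and3P [_ _ hj].
apply/eq_in_map => l; rewrite mem_iota => /andP [_ hl]; congr andb.
rewrite /col /pole !inordK //.
have [x hx ->] := normalizeE (zpole_pos hi); have [y hy ->] := normalizeE (zpole_pos hj).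
have [z hz ->] := normalizeE (zpole_pos hl); rewrite det3_scale det3_toR mulf_eq0 gt_eqF ?mulr_gt0 //=.
rewrite /zcol; apply/idP/eqP => [/Z.eqb_eq -> //|h].
by apply/Z.eqb_eq; apply: RIneq.eq_IZR.
Qed.

Lemma pole_oriented : check_oriented ->
  oriented (zarc arcs : 'I_n -> sarc) pole (dir_of dirs).
Proof.
move=> ho; set f : 'I_n -> 'I_5 := dir_of dirs.
have ind (i j : 'I_5) : i <> j -> forall s t : R,
    (forall m, s * dot m (toR (zpole i)) + t * dot m (toR (zpole j)) = 0) -> s = 0 /\ t = 0.
  move=> hij s t; apply: indep_eq0; rewrite gt_eqF // cross_toR; apply: nonzeroP.
  have := allP Hpoles i; rewrite mem_iota => /(_ (ltn_ord i)) /andP [_ /allP /(_ j)].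
  by rewrite mem_iota => /(_ (ltn_ord j)) /orP [/eqP h|//]; case: hij; apply: val_inj.
split; first by move=> i; apply: normalize_sphere; apply: zpole_pos.
split.
  move=> i j e; apply: contrapT => hij.
  have [x hx ex] := normalizeE (zpole_pos (ltn_ord i)); have [y hy ey] := normalizeE (zpole_pos (ltn_ord j)).
  have [x0 _] : x = 0 /\ - y = 0.
    apply: (ind i j hij) => m; have := congr1 (dot m) e; rewrite /pole ex ey !dotE; lra.
  by rewrite x0 ltxx in hx.
split.
  move=> i j e.
  have [x hx ex] := normalizeE (zpole_pos (ltn_ord i)); have [y hy ey] := normalizeE (zpole_pos (ltn_ord j)).
  have [eij|hij] := EM (i = j).
    have := congr1 (dot (pole i)) e; rewrite dotN eij.
    have := normalize_sphere (zpole_pos (ltn_ord j)); rewrite /on_sphere -/(pole j) => ->; lra.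
  have [x0 _] : x = 0 /\ y = 0.
    apply: (ind i j hij) => m; have := congr1 (dot m) e; rewrite /pole dotN ex ey !dotE; lra.
  by rewrite x0 ltxx in hx.
move=> a; have := allP ho a; rewrite mem_iota => /(_ (ltn_ord a)).
move=> /and3P [hdir]; have <- : f a = nth 0%N dirs a :> nat by rewrite /f /dir_of inordK.
move=> /Z.eqb_eq h1 /IZR_lt0; rewrite IZR_mul => h2.
have [x hx ex] := normalizeE (zend_pos Harcs false (ltn_ord a)).
have [y hy ey] := normalizeE (zend_pos Harcs true (ltn_ord a)).
have [c hc ec] := normalizeE (zpole_pos (ltn_ord (f a))).
rewrite -!det3_toR -!cross_toR in h2.
move: h1 h2 ex ey ec; set u := zend _ _ _; set v := zend _ _ _; set p := zpole _ => h1 h2 ex ey ec.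
have key (s t : R) : c *v toR p = (s * x) *v toR u +v (t * y) *v toR v ->
    c * det3 (toR p) (toR v) (cross (toR u) (toR v)) = s * x * dot (cross (toR u) (toR v)) (cross (toR u) (toR v)) /\
    c * det3 (toR u) (toR p) (cross (toR u) (toR v)) = t * y * dot (cross (toR u) (toR v)) (cross (toR u) (toR v)).
  move=> e; split.
    by rewrite -(det3_span1 _ _ _ (t * y)) -e /det3 /pscale /px /py /pz /=; ring.
  by rewrite -(det3_span2 _ _ (s * x)) -e /det3 /pscale /px /py /pz /=; ring.
(* Only the sign of [s * t] enters, so the pole and its antipode are excluded together. *)
have no (s t : R) : 0 <= s * t -> pole (f a) <> s *v src (zarc arcs a) +v t *v tgt (zarc arcs a).
  move=> st; rewrite /zarc /pole /= ex ey ec => e.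
  have [k1 k2] : c * det3 (toR p) (toR v) (cross (toR u) (toR v)) = s * x * dot (cross (toR u) (toR v)) (cross (toR u) (toR v)) /\
      c * det3 (toR u) (toR p) (cross (toR u) (toR v)) = t * y * dot (cross (toR u) (toR v)) (cross (toR u) (toR v)).
    by apply: key; rewrite e; apply: pt_ext => m; rewrite !dotE; ring.
  have : 0 < c * c by exact: mulr_gt0.
  have xy : 0 < x * y by exact: mulr_gt0.
  set k := dot _ _ in k1 k2; set d1 := det3 _ _ _ in h2 k1; set d2 := det3 _ _ _ in h2 k2 => cc.
  have : c * d1 * (c * d2) < 0.
    have -> : c * d1 * (c * d2) = c * c * (d1 * d2) by ring.
    by rewrite pmulr_rlt0.
  rewrite k1 k2; have -> : s * x * k * (t * y * k) = (s * t) * (x * y) * k ^+ 2 by ring.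
  apply/negP; rewrite -leNgt; apply: mulr_ge0; last exact: sqr_ge0.
  by apply: mulr_ge0 => //; exact: ltW.
split; last split.
- rewrite /zarc /pole /= ex ey ec det3_scale det3_toR h1.
  by rewrite mulr0.
- by move=> [_ [s [t [hs [ht e]]]]]; apply: (no s t) => //; apply: mulr_ge0.
- move=> [_ [s [t [hs [ht e]]]]]; apply: (no (- s) (- t)); first by rewrite mulrNN mulr_ge0.
  by apply: pt_ext => m; have := congr1 (dot m) e; rewrite dotN !dotE; lra.
Qed.

End Poles.

(* The vertices of a regular tetrahedron, and a direction in the planes of two opposite
   pairs of them. *)
Definition tetra_poles : seq zpt := [:: (1, 1, 1); (1, -1, -1); (-1, 1, -1); (-1, -1, 1); (1, 0, 0)]%ZZ.

(** * The diagrams with eight and with nine arcs *)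

Definition arcs8 : seq (zpt * zpt) := [::
  (((-8), (-3), (-2)), (18, (-3), (-2)));
  ((1, 2, (-3)), ((-7), (-3), (-1)));
  (((-5), 7, 1), (0, 1, (-2)));
  (((-1), 3, 5), (4, (-3), (-2)));
  (((-5), (-3), (-2)), (1, 5, 7));
  (((-1), 2, 0), ((-11), 1, 7));
  ((5, (-2), 1), ((-1), 4, (-5)));
  ((1, 1, 3), ((-3), 5, (-1)))]%ZZ.

Definition dirs8 : seq nat := [:: 4; 3; 1; 1; 0; 3; 2; 2]%N.

Definition blocks8 : seq (nat * nat) := [:: (1, 6); (6, 4); (5, 1); (4, 0); (0, 7); (7, 4); (3, 2); (3, 2)]%N.

(** Five swirls of three arcs each, two counterclockwise and three clockwise; the same holds for
    [swirls9]. *)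
Definition swirls8 : seq (bool * (nat * bool) * nat) := [:: (false, (6, false), 3); (false, (7, true), 3); (true, (0, false), 3); (true, (6, true), 3); (true, (3, false), 3)]%N.

Definition arcs9 : seq (zpt * zpt) := [::
  (((-3), 0, 4), (1, (-25), 7));
  (((-27), 43, 33), (51, 5, (-30)));
  ((15, 17, (-3)), ((-19), (-17), 31));
  (((-31), (-25), (-17)), (11, 17, 25));
  ((6, 2, (-3)), ((-5), (-13), 11));
  ((4, (-8), 5), ((-4), 0, (-3)));
  (((-7), 0, (-1)), (4, 0, (-1)));
  (((-31), (-17), (-19)), (18, 25, 24));
  (((-48), 1, (-6)), (21, 1, (-6)))]%ZZ.

Definition dirs9 : seq nat := [:: 1; 1; 3; 0; 3; 2; 4; 0; 4]%N.

Definition blocks9 : seq (nat * nat) := [:: (3, 5); (7, 8); (1, 0); (5, 2); (1, 0); (4, 6); (7, 4); (5, 2); (7, 4)]%N.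

Definition swirls9 : seq (bool * (nat * bool) * nat) := [:: (false, (5, false), 3); (false, (1, false), 3); (true, (0, false), 3); (true, (5, true), 3); (true, (1, true), 3)]%N.

Lemma check_tetra_poles : check_poles tetra_poles.
Proof. by vm_compute. Qed.

Lemma tetra_alignment : has_alignment (pole tetra_poles) [:: 2; 3; 3; 3; 3]%N.
Proof. by apply: (pole_alignment check_tetra_poles); vm_compute. Qed.

Lemma eight_arcs : exists (D : 'I_8 -> sarc) (P : 'I_5 -> pt) (f : 'I_8 -> 'I_5),
  spherical_diagram D /\ oriented D P f /\ has_alignment P [:: 2; 3; 3; 3; 3]%N /\ exactly_swirls D 5.
Proof.
have H1 : check_arcs 7 arcs8 by vm_compute.
have H2 : check_hits 7 arcs8 blocks8 by vm_compute.
have H3 : check_disjoint 7 arcs8 by vm_compute.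
exists (zarc arcs8), (pole tetra_poles), (dir_of dirs8).
split; first exact: zarc_diagram H1 H2 H3.
split; first by apply: (pole_oriented H1 check_tetra_poles); vm_compute.
split; first exact: tetra_alignment.
by apply: (certified_swirls H1 H2 H3 (swirls := swirls8)) => //; vm_compute.
Qed.

Lemma nine_arcs : exists (D : 'I_9 -> sarc) (P : 'I_5 -> pt) (f : 'I_9 -> 'I_5),
  spherical_occlusion_diagram D /\ oriented D P f /\ has_alignment P [:: 2; 3; 3; 3; 3]%N /\
  exactly_swirls D 5.
Proof.
have H1 : check_arcs 8 arcs9 by vm_compute.
have H2 : check_hits 8 arcs9 blocks9 by vm_compute.
have H3 : check_disjoint 8 arcs9 by vm_compute.
exists (zarc arcs9), (pole tetra_poles), (dir_of dirs9).
split; first by apply: (zarc_occlusion H1 H2 H3); vm_compute.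
split; first by apply: (pole_oriented H1 check_tetra_poles); vm_compute.
split; first exact: tetra_alignment.
by apply: (certified_swirls H1 H2 H3 (swirls := swirls9)) => //; vm_compute.
Qed.

Theorem mainTheorem5 :
  (forall (n : nat) (D : 'I_n -> sarc) (P : 'I_5 -> pt) (f : 'I_n -> 'I_5),
     spherical_diagram D -> oriented D P f -> has_alignment P [:: 2; 3; 3; 3; 3]%N ->
     at_least_swirls D 5)
  /\ (exists (D : 'I_8 -> sarc) (P : 'I_5 -> pt) (f : 'I_8 -> 'I_5),
        spherical_diagram D /\ oriented D P f /\ has_alignment P [:: 2; 3; 3; 3; 3]%N /\
        exactly_swirls D 5)
  /\ (exists (D : 'I_9 -> sarc) (P : 'I_5 -> pt) (f : 'I_9 -> 'I_5),
        spherical_occlusion_diagram D /\ oriented D P f /\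
        has_alignment P [:: 2; 3; 3; 3; 3]%N /\ exactly_swirls D 5).
Proof. exact: conj lower_bound (conj eight_arcs nine_arcs). Qed.
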